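(* Let $m\ge3$, $r\in(0,\pi/2)$ and $(f,\Gamma)$ an elliptic data. If $g=e^{2\rho}g_0$, $\rho\in C^{2,\alpha}(\overline{\mathbb{A}(r)})$, satisfies $f(\lambda(g))=0$ (with $\lambda(g)\in\overline\Gamma$) in $\overline{\mathbb{A}(r)}$ and $h(g)=0$ on both components of $\partial\mathbb{A}(r)$, then $g$ is rotationally invariant ($\rho$ depends only on $d_{\mathbb{S}^m}(x,{\bf n})$), and it is unique up to dilations: any other such solution $g_1$ satisfies $g_1=e^{2t}g$ for some constant $t\in\mathbb{R}$.
   Context: $\mathbb{S}^m\subset\mathbb{R}^{m+1}$ is the unit sphere with round metric $g_0$; ${\bf n}=e_{m+1}$; $\mathbb{A}(r)=\{x\in\mathbb{S}^m: r<d_{\mathbb{S}^m}(x,{\bf n})<\pi/2\}$, whose boundary consists of the geodesic spheres $\partial B_r({\bf n})$ and $\partial\mathbb{S}^m_+=\{x_{m+1}=0\}$. $\lambda(g)$ are the eigenvalues of $g^{-1}\mathrm{Sch}(g)$, $\mathrm{Sch}(g)=\frac{1}{m-2}(\mathrm{Ric}(g)-\frac{R(g)}{2(m-1)}g)$. Elliptic data: $(f,\Gamma)$ with $\Gamma\subset\mathbb{R}^m$ an open convex symmetric cone, $\{x_i>0\ \forall i\}\subset\Gamma\subset\{\sum x_i>0\}$, and $f\in C^0(\overline\Gamma)\cap C^1(\Gamma)$ symmetric, $f=0$ on $\partial\Gamma$, $f>0$ on $\Gamma$, homogeneous of degree 1, all partial derivatives of $f$ positive on $\Gamma$. $h(g)=0$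 means the boundary component is minimal for $g$; for a geodesic sphere $\partial B_s(p)$ with unit normal $\nu$ this is $\partial\rho/\partial\nu=\cot s$ (for the equator: $\partial\rho/\partial x_{m+1}=0$). *)

(* Defs.v *)
From HB Require Import structures.
From mathcomp Require Import all_boot all_order all_algebra all_fingroup.
From mathcomp Require Import all_classical all_reals all_analysis.
Import Order.TTheory GRing.Theory Num.Theory.
Import numFieldNormedType.Exports.
Local Open Scope classical_set_scope.
Local Open Scope ring_scope.

Set Implicit Arguments.
Unset Strict Implicit.
Unset Printing Implicit Defensive.

Definition edot {R : realType} {n : nat} (x y : 'rV[R]_n) : R :=
  \sum_(i < n) x 0 i * y 0 i.
Definition enorm {R : realType} {n : nat} (x : 'rV[R]_n) : R :=
  Num.sqrt (edot x x).
Definition evec {R : realType} {n : nat} (i : 'I_n) : 'rV[R]_n := delta_mx 0 i.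

Definition pd {R : realType} {n : nat} (i : 'I_n) (f : 'rV[R]_n -> R)
  (y : 'rV[R]_n) : R := 'D_(evec i) f y.

Definition onSphere {R : realType} {m : nat} (x : 'rV[R]_m.+1) : Prop :=
  edot x x = 1.
Definition npole {R : realType} {m : nat} : 'rV[R]_m.+1 := delta_mx 0 ord_max.
Definition sdist {R : realType} {m : nat} (x y : 'rV[R]_m.+1) : R :=
  acos (edot x y).
Definition closedAnnulus {R : realType} {m : nat} (r : R) (x : 'rV[R]_m.+1) : Prop :=
  onSphere x /\ r <= sdist x npole <= pi / 2.

(* inverse stereographic projection from the south pole -n : R^m -> S^m \ {-n};
   it is a chart containing the whole closed annulus. *)
Definition stereo {R : realType} {m : nat} (y : 'rV[R]_m) : 'rV[R]_m.+1 :=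
  \row_(i < m.+1) match unlift ord_max i with
                  | Some j => 2 * y 0 j / (1 + edot y y)
                  | None => (1 - edot y y) / (1 + edot y y)
                  end.

(* polar parametrisation: the point at distance t from n along the unit
   equatorial direction w *)
Definition polar {R : realType} {m : nat} (t : R) (w : 'rV[R]_m.+1) : 'rV[R]_m.+1 :=
  cos t *: npole + sin t *: w.

Definition gmet {R : realType} {m : nat} (rho : 'rV[R]_m.+1 -> R) (y : 'rV[R]_m)
  : 'M[R]_m :=
  \matrix_(i < m, j < m)
    (expR (2 * rho (stereo y)) *
     edot ('D_(evec i) (@stereo R m) y) ('D_(evec j) (@stereo R m) y)).

Definition ginv {R : realType} {m : nat} (rho : 'rV[R]_m.+1 -> R) (y : 'rV[R]_m)
  : 'M[R]_m := invmx (gmet rho y).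

Definition christoffel {R : realType} {m : nat} (rho : 'rV[R]_m.+1 -> R)
  (k i j : 'I_m) (y : 'rV[R]_m) : R :=
  2^-1 * \sum_(l < m) ginv rho y k l *
     (pd i (fun z => gmet rho z j l) y + pd j (fun z => gmet rho z i l) y
      - pd l (fun z => gmet rho z i j) y).

Definition ricci {R : realType} {m : nat} (rho : 'rV[R]_m.+1 -> R) (y : 'rV[R]_m)
  : 'M[R]_m :=
  \matrix_(i < m, j < m) \sum_(k < m)
    (pd k (christoffel rho k i j) y - pd j (christoffel rho k i k) y
     + \sum_(l < m) (christoffel rho k k l y * christoffel rho l i j y
                     - christoffel rho k j l y * christoffel rho l i k y)).

Definition scal {R : realType} {m : nat} (rho : 'rV[R]_m.+1 -> R) (y : 'rV[R]_m) : R :=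
  \sum_(i < m) \sum_(j < m) ginv rho y i j * ricci rho y i j.

Definition schouten {R : realType} {m : nat} (rho : 'rV[R]_m.+1 -> R) (y : 'rV[R]_m)
  : 'M[R]_m :=
  ((m%:R - 2)^-1) *: (ricci rho y - (scal rho y / (2 * (m%:R - 1))) *: gmet rho y).

Definition schEnd {R : realType} {m : nat} (rho : 'rV[R]_m.+1 -> R) (y : 'rV[R]_m)
  : 'M[R]_m := ginv rho y *m schouten rho y.

Definition eigenvalues_are {R : realType} {m : nat} (A : 'M[R]_m) (lam : 'rV[R]_m)
  : Prop := char_poly A = \prod_(i < m) ('X - (lam 0 i)%:P).

Definition elliptic_data {R : realType} {m : nat} (f : 'rV[R]_m -> R)
  (Gam : set 'rV[R]_m) : Prop :=
  [/\ open Gam,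
      (forall a b (t : R), Gam a -> Gam b -> 0 <= t <= 1 ->
          Gam (t *: a + (1 - t) *: b)),
      (forall (t : R) a, 0 < t -> Gam a -> Gam (t *: a)),
      (forall (s : 'S_m) a, Gam a -> Gam (col_perm s a)) &
      ([set x : 'rV[R]_m | forall i, 0 < x 0 i] `<=` Gam /\
       Gam `<=` [set x : 'rV[R]_m | 0 < \sum_(i < m) x 0 i])] /\
  [/\ {within closure Gam, continuous f},
      (forall x, Gam x -> differentiable f x),
      (forall i, {within Gam, continuous (pd i f)}),
      (forall (s : 'S_m) a, closure Gam a -> f (col_perm s a) = f a) &
      ((forall a, closure Gam a -> ~ Gam a -> f a = 0) /\
       (forall a, Gam a -> 0 < f a))] /\
  (forall (t : R) a, 0 < t -> closure Gam a -> f (t *: a) = t * f a) /\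
  (forall i a, Gam a -> 0 < pd i f a).

(* expressed in the stereographic chart, which contains the closed annulus:
   u = rho o stereo is C^2 on an open neighbourhood of the (compact) preimage K
   of the closed annulus, and its second derivatives are alpha-Hoelder on K *)
Definition C2alpha_annulus {R : realType} {m : nat} (r : R)
  (rho : 'rV[R]_m.+1 -> R) : Prop :=
  let u := rho \o (@stereo R m) in
  let K := (@stereo R m) @^-1` (closedAnnulus r) in
  exists U : set 'rV[R]_m,
    [/\ open U, K `<=` U,
        (forall y, U y -> differentiable u y /\ forall j, differentiable (pd j u) y),
        (forall i j, {within U, continuous (pd i (pd j u))}) &
        exists alpha C : R, 0 < alpha < 1 /\
          forall i j y z, K y -> K z ->
            `|pd i (pd j u) y - pd i (pd j u) z| <= C * powR (enorm (y - z)) alpha].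

(* f(lambda(g)) = 0, lambda(g) in closure Gamma, on the closed annulus, and both
   boundary components minimal: on d B_r(n) the derivative of rho along the
   unit normal pointing towards n equals cot r, i.e. the derivative along the
   outgoing radial geodesic equals -cot r; on the equator d rho/d x_{m+1} = 0. *)
Definition solves_problem {R : realType} {m : nat} (f : 'rV[R]_m -> R)
  (Gam : set 'rV[R]_m) (r : R) (rho : 'rV[R]_m.+1 -> R) : Prop :=
  C2alpha_annulus r rho /\
  (forall y : 'rV[R]_m, closedAnnulus r (stereo y) ->
     exists lam : 'rV[R]_m,
       eigenvalues_are (schEnd rho y) lam /\ closure Gam lam /\ f lam = 0) /\
  (forall w : 'rV[R]_m.+1, onSphere w -> w 0 ord_max = 0 ->
     derive1 (fun t : R => rho (polar t w)) r = - (cos r / sin r) /\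
     derive1 (fun t : R => rho (polar t w)) (pi / 2) = 0).

(* Main.v *)
Require Import Defs.
From HB Require Import structures.
From mathcomp Require Import all_boot all_order all_algebra all_fingroup.
From mathcomp Require Import all_classical all_reals all_analysis.
From mathcomp Require Import complex ring lra.
Import Order.TTheory GRing.Theory Num.Theory.
Import numFieldNormedType.Exports.
Local Open Scope classical_set_scope.
Local Open Scope ring_scope.

(** In the stereographic chart write the metric as [exp (2V) |dy|^2]; its Schouten
    tensor is [A = - D^2 V + dV (x) dV - |dV|^2 / 2]. With [s = ln |y|] and
    [w = V + s] the metric is [exp (2w) (ds^2 + dtheta^2)] on a cylinder, and both
    boundary components are minimal iff [w_s = 0] there. The cylinder itself has
    eigenvalues proportional to [v = (-1, 1, ..., 1)], and every solution turns out
    to have [w] constant, which gives both assertions at once.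

    If [v] were in the open cone, a maximum of [w] (tilted slightly so that it is
    interior) would satisfy [A >= A_cyl], hence have eigenvalues in the open cone,
    where [f > 0]. So [v] is not in the cone, and by symmetry and convexity every
    [x] in the closure satisfies [(m - 2) x_j + sum_i x_i >= 0] for all [j]. Applied
    in the radial direction this makes [V] a supersolution of the linear elliptic
    operator [|y|^2 Lap + (m - 2) D^2(y, y)], for which [ln |y|] is a solution; the
    strong minimum principle with the Neumann condition forces [w] to be constant. *)

Set Implicit Arguments.
Unset Strict Implicit.
Unset Printing Implicit Defensive.

(** * Symmetric matrices and their eigenvalues *)

(** The eigenvalues of a solution lie in the closed cone but not in the open one, and on the
    boundary of the cone [f] is only known to be continuous, so the equation cannot be linearised
    along a path joining two solutions. Each solution is therefore compared with the cylinder, and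
    what the comparison uses of the equation is the position of the eigenvalues relative to the
    cone.

    In the coordinates s = ln |y| and theta = y / |y|, the operator |y|^2 Lap + (m - 2) D^2(y, y)
    becomes (m - 1) d^2/ds^2 + Lap_theta. The first-order terms cancel, which is why ln |y| = s is a
    solution.

    The minimum principle is proved with a single barrier defined on the whole annulus and centred
    at a point where w exceeds its minimum. It takes the place of both the boundary point lemma and
    the propagation of the minimum set through chains of balls. *)

Lemma char_poly_conj (F : fieldType) (n : nat) (P A : 'M[F]_n) :
  P \in unitmx -> char_poly (invmx P *m A *m P) = char_poly A.
Proof.
move=> Pu; rewrite /char_poly /char_poly_mx.
set Q := map_mx polyC P; set B := map_mx polyC A.
have VQ : map_mx polyC (invmx P) *m Q = 1%:M.
  by rewrite -map_mxM mulVmx // map_mx1.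
rewrite !map_mxM -/Q -/B.
have -> : 'X%:M - map_mx polyC (invmx P) *m B *m Q =
          map_mx polyC (invmx P) *m ('X%:M - B) *m Q.
  rewrite mulmxBr mulmxBl; congr (_ - _).
  by rewrite scalar_mxC -mulmxA VQ mulmx1.
by rewrite !det_mulmx mulrAC -det_mulmx VQ det1 mul1r.
Qed.

Definition qform (R : realType) (m : nat) (A : 'M[R]_m) (z : 'rV[R]_m) : R :=
  \sum_(i < m) \sum_(j < m) z 0 i * A i j * z 0 j.

Section SpectralResolution.
Local Open Scope sesquilinear_scope.

(* The complex spectral theorem read over the reals: the rows of [X] and [Y]
   are the real and imaginary parts of a unitary eigenbasis. *)
Lemma spectral_resolution (R : realType) (m : nat) (A : 'M[R]_m)
    (lam : 'rV[R]_m) : A^T = A -> eigenvalues_are A lam ->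
  exists X Y : 'M[R]_m,
  [/\ forall k, edot (row k X) (row k X) + edot (row k Y) (row k Y) = 1,
      forall k, lam 0 k = qform A (row k X) + qform A (row k Y),
      forall z, \sum_k (edot (row k X) z ^+ 2 + edot (row k Y) z ^+ 2) =
                edot z z &
      forall z, qform A z =
        \sum_k lam 0 k * (edot (row k X) z ^+ 2 + edot (row k Y) z ^+ 2)].
Proof.
move=> Asym Alam.
pose Ac := map_mx (real_complex R) A.
have Aherm : Ac \is hermsymmx.
  apply: realsym_hermsym.
    apply/is_hermitianmxP; rewrite expr0 scale1r map_mx_id //.
    by apply/matrixP => i j; rewrite !mxE -{1}Asym mxE.
  by apply/mxOverP => i j; rewrite mxE realE -[0]/(0%:C)%C !lecR; exact: le_total.
have := hermitian_normalmx Aherm => /orthomx_spectralP.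
have := spectral_unitarymx Ac; set P := spectralmx Ac; set D := spectral_diag Ac.
move=> Pu AE.
have PPt : P *m P^t* = 1%:M by apply/unitarymxP.
have PtP : P^t* *m P = 1%:M by apply: mulmx1C.
have AE2 : Ac = P^t* *m diag_mx D *m P by rewrite -invmx_unitary.
(* Two factorisations of one characteristic polynomial agree up to a permutation [s] of the roots.
   Indexing the rows of [X] and [Y] through [s^-1] puts the eigenvectors in the order of [lam]. *)
have : \prod_(i < m) ('X - (D 0 i)%:P) =
       \prod_(i < m) ('X - ((lam 0 i)%:C%C)%:P).
  have := congr1 (@char_poly _ _) AE.
  rewrite char_poly_conj ?unitarymx_unit // -map_char_poly Alam rmorph_prod /=.
  rewrite char_poly_trig ?diag_mx_is_trig // => EE.
  transitivity (\prod_(i < m) ('X - (diag_mx D i i)%:P)).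
    by apply: eq_bigr => i _; rewrite mxE eqxx.
  rewrite -EE; apply: eq_bigr => i _.
  by rewrite rmorphB /= map_polyX map_polyC.
pose tD := [tuple D 0 i | i < m].
pose tl := [tuple (lam 0 i)%:C%C | i < m].
have -> : \prod_(i < m) ('X - (D 0 i)%:P) = \prod_(x <- tD) ('X - x%:P).
  by rewrite big_tuple; apply: eq_bigr => i _; rewrite tnth_mktuple.
have -> : \prod_(i < m) ('X - ((lam 0 i)%:C%C)%:P) = \prod_(x <- tl) ('X - x%:P).
  by rewrite big_tuple; apply: eq_bigr => i _; rewrite tnth_mktuple.
move=> /prod_XsubC_eq /tuple_permP [s Es].
have Ds k : D 0 k = (lam 0 (s k))%:C%C.
  have := congr1 (fun t => nth 0 t k) Es.
  rewrite (_ : nth 0 (tval tD) k = D 0 k); last first.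
    by rewrite -tnth_nth tnth_mktuple.
  by move=> ->; rewrite -tnth_nth !tnth_mktuple.
pose X : 'M[R]_m := \matrix_(k, j) complex.Re (P (s^-1%g k) j).
pose Y : 'M[R]_m := \matrix_(k, j) complex.Im (P (s^-1%g k) j).
have PE k j : P k j = Complex (X (s k) j) (Y (s k) j).
  by rewrite !mxE permK; case: (P k j).
have Re_sum (n : nat) (F : 'I_n -> R[i]) : complex.Re (\sum_(i < n) F i) =
    \sum_(i < n) complex.Re (F i).
  by apply: (big_morph (@complex.Re R)) => // -[? ?] [? ?].
have edotE (Z : 'M[R]_m) k z : edot (row k Z) z = \sum_j Z k j * z 0 j.
  by apply: eq_bigr => j _; rewrite mxE.
have zPE z k : (P *m (map_mx (real_complex R) z)^T) k 0 =
    Complex (edot (row (s k) X) z) (edot (row (s k) Y) z).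
  rewrite mxE !edotE.
  have -> : forall F G : 'I_m -> R, Complex (\sum_j F j) (\sum_j G j) =
     \sum_j Complex (F j) (G j).
    by move=> F G; elim/big_rec3: _ => // j a b c _ <-.
  by apply: eq_bigr => j _; rewrite PE !mxE; simpc.
have zPE' z k : (map_mx (real_complex R) z *m P^t*) 0 k =
    Complex (edot (row (s k) X) z) (- edot (row (s k) Y) z).
  rewrite mxE !edotE -sumrN.
  have -> : forall F G : 'I_m -> R, Complex (\sum_j F j) (\sum_j G j) =
     \sum_j Complex (F j) (G j).
    by move=> F G; elim/big_rec3: _ => // j a b c _ <-.
  by apply: eq_bigr => j _; rewrite !mxE PE; simpc; rewrite !mxE; congr Complex; ring.
exists X, Y; split.
- move=> k; have := congr1 (fun M : 'M[R[i]]_m => complex.Re (M (s^-1%g k) (s^-1%g k))) PPt.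
  rewrite !mxE eqxx /= Re_sum => <-.
  rewrite /edot -big_split /=; apply: eq_bigr => j _.
  by rewrite !mxE; case: (P _ _) => a b /=; ring.
- move=> k.
  have : P *m Ac *m P^t* = diag_mx D.
    by rewrite AE2 !mulmxA PPt mul1mx -mulmxA PPt mulmx1.
  move=> /(congr1 (fun M : 'M[R[i]]_m => complex.Re (M (s^-1%g k) (s^-1%g k)))).
  rewrite [in RHS]mxE eqxx /= Ds permKV /= => <-.
  rewrite mxE Re_sum /qform -big_split /=.
  under [RHS]eq_bigr do rewrite -big_split /=.
  rewrite [RHS]exchange_big /=; apply: eq_bigr => j _.
  rewrite mxE mulr_suml Re_sum; apply: eq_bigr => i _.
  rewrite !mxE; case: (P _ i) => a b; case: (P _ j) => c d /=; ring.
- move=> z; have : (map_mx (real_complex R) z *m P^t*) *m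
     (P *m (map_mx (real_complex R) z)^T) = map_mx (real_complex R) (z *m z^T).
    by rewrite mulmxA -[_ *m _ *m P]mulmxA PtP mulmx1 map_mxM map_trmx.
  move=> /(congr1 (fun M : 'M[R[i]]_1 => complex.Re (M 0 0))).
  rewrite [in RHS]mxE [in RHS]mxE /= => E.
  transitivity (\sum_j z 0 j * z^T j 0); last by apply: eq_bigr => j _; rewrite mxE.
  rewrite -E mxE Re_sum (reindex_inj (@perm_inj _ s)) /=; apply: eq_bigr => k _.
  by rewrite zPE zPE' /= -/(edot _ _) -/(edot _ _); ring.
- move=> z; have : (map_mx (real_complex R) z *m P^t*) *m (diag_mx D *m
     (P *m (map_mx (real_complex R) z)^T)) =
     map_mx (real_complex R) (z *m A *m z^T).
    by rewrite !mulmxA -[_ *m _ *m P]mulmxA -[_ *m (_ *m P)]mulmxA;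
       rewrite [P^t* *m _]mulmxA -AE2 !map_mxM map_trmx.
  move=> /(congr1 (fun M : 'M[R[i]]_1 => complex.Re (M 0 0))).
  rewrite [in RHS]mxE /= => E.
  transitivity ((z *m A *m z^T) 0 0).
    rewrite mxE /qform exchange_big /=; apply: eq_bigr => j _.
    by rewrite !mxE mulr_suml; apply: eq_bigr => i _.
  rewrite -E mxE Re_sum [RHS](reindex_inj (@perm_inj _ s)) /=; apply: eq_bigr => k _.
  by rewrite mul_diag_mx zPE' mxE zPE Ds /=; ring.
Qed.

End SpectralResolution.

(** * Cones *)

Section Cones.
Variables (R : realType) (m : nat) (Gam : set 'rV[R]_m).
Hypothesis Gopen : open Gam.
Hypothesis Gconv : forall a b (t : R), Gam a -> Gam b -> 0 <= t <= 1 ->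
  Gam (t *: a + (1 - t) *: b).
Hypothesis Gcone : forall (t : R) a, 0 < t -> Gam a -> Gam (t *: a).
Hypothesis Gsym : forall (s : 'S_m) a, Gam a -> Gam (col_perm s a).
Hypothesis Gpos : [set x : 'rV[R]_m | forall i, 0 < x 0 i] `<=` Gam.
Hypothesis Gsum : Gam `<=` [set x : 'rV[R]_m | 0 < \sum_(i < m) x 0 i].

Lemma coneD a b : Gam a -> Gam b -> Gam (a + b).
Proof.
move=> Ga Gb; have := Gcone (ltr0Sn R 1) (Gconv Ga Gb (t := 2^-1) _).
have h : (0 <= 2^-1 :> R) && (2^-1 <= 1 :> R) by apply/andP; split; lra.
move=> /(_ h); congr Gam; rewrite scalerDr !scalerA.
by rewrite (_ : 2 * (1 - 2^-1) = 1) ?divff ?scale1r //; lra.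
Qed.

Lemma open_cone_sub a : Gam a -> exists2 e : R, 0 < e & Gam (a - const_mx e).
Proof.
move=> Ga; have /nbhs_ballP[e /= e0 eG] := open_nbhs_nbhs (conj Gopen Ga).
exists (e / 2); first by rewrite divr_gt0.
apply: eG; rewrite -ball_normE /ball_ /= opprB addrC subrK.
rewrite /Num.Def.normr /= mx_normrE; apply/bigmax_ltP; split => // -[i j] _ /=.
by rewrite mxE gtr0_norm ?divr_gt0 // ltr_pdivrMr // mulr_natr mulr2n ltrDl.
Qed.

(** By openness a small [e] can be subtracted from every entry of [a]; the remainder [b - a + e] is
    then strictly positive even where [a] and [b] agree. *)
Lemma cone_le (a b : 'rV[R]_m) : Gam a -> (forall i, a 0 i <= b 0 i) -> Gam b.
Proof.
move=> /open_cone_sub[e e0 Ga] ab.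
have -> : b = (a - const_mx e) + (b - a + const_mx e).
  by apply/rowP => i; rewrite !mxE; ring.
apply: coneD => //; apply: Gpos => i /=; rewrite !mxE.
by have := ab i; lra.
Qed.

Lemma cone_sum (I : finType) (P : {pred I}) (w : I -> R) (a : I -> 'rV[R]_m) :
  (forall i, P i -> 0 <= w i) -> 0 < \sum_(i | P i) w i ->
  (forall i, P i -> Gam (a i)) -> Gam (\sum_(i | P i) w i *: a i).
Proof.
move=> w0 ws Ga.
(* The cone does not contain 0, so the induction separates a partial sum of zero weight, which is
   the zero vector, from one of positive weight. *)
suff : forall (x : R) (v : 'rV[R]_m), (x, v) =
    (\sum_(i | P i) w i, \sum_(i | P i) w i *: a i) ->
    0 <= x /\ (if x == 0 then v = 0 else Gam v).
  by move=> /(_ _ _ erefl) []; rewrite gt_eqF.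
move=> x v [-> ->] {x v ws}.
elim/big_rec2: _ => [|i v x Pi [x0 IH]]; first by rewrite lexx eqxx.
have wi0 := w0 i Pi; split; first exact: addr_ge0.
have [x00|xn0] := eqVneq x 0.
  move: IH; rewrite x00 eqxx => ->; rewrite !addr0.
  have [->|wn0] := eqVneq (w i) 0; first by rewrite scale0r.
  by apply: Gcone (Ga i Pi); rewrite lt0r wn0.
move: IH; rewrite (negbTE xn0) => Gv.
have xp : 0 < x by rewrite lt0r xn0.
rewrite gt_eqF; last by apply: ltr_wpDl.
have [->|wn0] := eqVneq (w i) 0; first by rewrite scale0r add0r.
by apply: coneD => //; apply: Gcone (Ga i Pi); rewrite lt0r wn0.
Qed.

(** For [c = 2] this is, up to a positive factor, the Schouten spectrum of the cylinder with axis
    direction [j]; varying [c] leaves room for perturbation. *)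
Definition spike (c : R) (j : 'I_m) : 'rV[R]_m := const_mx 1 - c *: evec j.

Lemma spikeE c j i : spike c j 0 i = 1 - c * (i == j)%:R.
Proof. by rewrite !mxE eqxx andTb. Qed.

Lemma cone_spike_sym c j k : Gam (spike c j) -> Gam (spike c k).
Proof.
move=> /(Gsym (tperm j k)); congr Gam; apply/rowP => i.
rewrite mxE !spikeE; congr (_ - _ * _%:R).
by rewrite -(inj_eq (@perm_inj _ (tperm j k))) tpermK tpermL.
Qed.

Lemma cone_spike_le c d j : Gam (spike c j) -> d <= c -> Gam (spike d j).
Proof.
move=> Gc dc; apply: (cone_le Gc) => i; rewrite !spikeE lerD2l lerN2.
by rewrite ler_wpM2r.
Qed.

Lemma cone_spike_open c j : Gam (spike c j) ->
  exists2 eta : R, 0 < eta & Gam (spike (c + eta) j).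
Proof.
move=> /open_cone_sub[e e0 Ge]; exists e => //; apply: (cone_le Ge) => i.
rewrite mxE spikeE !mxE eqxx /=.
by case: (i == j) => /=; rewrite ?mulr1 ?mulr0; lra.
Qed.

Hypothesis m3 : (3 <= m)%N.

(* Averaging [x] over the permutations fixing [j] reduces a violation of the
   inequality to the spike direction itself. *)
Lemma cone_spike_support j x : ~ Gam (spike 2 j) -> Gam x ->
  0 <= (m%:R - 2) * x 0 j + \sum_i x 0 i.
Proof.
move=> nG Gx; rewrite leNgt; apply/negP => xneg; apply: nG.
pose S := [set s : 'S_m | s j == j]%SET.
have S0 : (0 < #|S|)%N by apply/card_gt0P; exists 1%g; rewrite inE perm1.
pose v := \sum_(s in S) (1 : R) *: col_perm s x.
have Gv : Gam v.
  apply: cone_sum => [//||s _]; last exact: Gsym.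
  by rewrite sumr_const pmulrn_lgt0.
pose n : R := #|S|%:R.
have n0 : 0 < n by rewrite ltr0n.
have vj : v 0 j = n * x 0 j.
  rewrite summxE (eq_bigr (fun=> x 0 j)); last first.
    by move=> s; rewrite inE !mxE => /eqP ->; rewrite mul1r.
  by rewrite sumr_const mulr_natl.
have vs : \sum_i v 0 i = n * \sum_i x 0 i.
  under eq_bigr do rewrite summxE; rewrite exchange_big /=.
  rewrite (eq_bigr (fun=> \sum_i x 0 i)); last first.
    move=> s _; rewrite [RHS](reindex_inj (@perm_inj _ s)) /=.
    by apply: eq_bigr => i _; rewrite !mxE mul1r.
  by rewrite sumr_const mulr_natl.
(* Composing with the transposition of [i] and [k] permutes the stabiliser of [j], so the sum over
   it is constant away from [j]. *)
have vc i k : i != j -> k != j -> v 0 i = v 0 k.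
  move=> ij kj; rewrite /v !summxE (reindex_inj (mulgI (tperm i k))) /=.
  apply: eq_big => s; rewrite !inE ?permM ?tpermD // ?(eq_sym _ j) //.
  by move=> _; rewrite !mxE permM tpermL.
have [k kj] : exists k : 'I_m, k != j.
  have : (1 < #|'I_m|)%N by rewrite card_ord; apply: leq_trans m3.
  move=> /card_gt1P[a [b [_ _ ab]]].
  by case: (eqVneq a j) => [aj|]; [exists b; rewrite -aj eq_sym | exists a].
have vs2 : \sum_i v 0 i = v 0 j + (m%:R - 1) * v 0 k.
  rewrite (bigD1 j) //=; congr (_ + _).
  rewrite (eq_bigr (fun=> v 0 k)); last by move=> i ij; apply: vc.
  rewrite sumr_const (eq_card (B := predC1 j)) // cardC1 card_ord.
  have -> : m%:R - 1 = m.-1%:R :> R by rewrite -subn1 natrB // (leq_trans _ m3).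
  by rewrite mulr_natl.
have m3' : 3 <= m%:R :> R by rewrite ler_nat.
(* The violated inequality factors as (m - 1) (v_j + v_k) < 0. Positivity of the sum of all entries
   then forces v_k > 0, and division by v_k leaves ones off [j] and an entry below -1 at [j], a
   vector dominated by [spike 2 j]. *)
have vneg : v 0 j + v 0 k < 0.
  have : (m%:R - 2) * v 0 j + \sum_i v 0 i < 0.
    by rewrite vs vj mulrCA -mulrDr pmulr_rlt0.
  rewrite vs2; set M := m%:R in m3' *; move=> h.
  have : (M - 1) * (v 0 j + v 0 k) < 0 by lra.
  by rewrite pmulr_rlt0 //; lra.
have vpos : 0 < v 0 k.
  have := Gsum Gv; rewrite /= vs2; set M := m%:R in m3' *; move=> h.
  rewrite ltNge; apply/negP => vk0.
  have : (M - 2) * v 0 k <= 0 by rewrite mulr_ge0_le0 //; lra.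
  by lra.
have := Gcone (t := (v 0 k)^-1) _ Gv; rewrite invr_gt0 vpos => /(_ isT) Gk.
apply: (cone_le Gk) => i; rewrite spikeE mxE.
have [->|ij] := eqVneq i j; rewrite ?mulr1 ?mulr0.
  by rewrite mulrC ler_pdivrMr //; lra.
by rewrite (vc i k) // mulVf ?gt_eqF //; lra.
Qed.

Lemma closure_spike_support j (x : 'rV[R]_m) : ~ Gam (spike 2 j) -> closure Gam x ->
  0 <= (m%:R - 2) * x 0 j + \sum_i x 0 i.
Proof.
move=> nG cx; rewrite leNgt; apply/negP => xneg.
pose L : 'rV[R]_m -> R := fun y => (m%:R - 2) * y 0 j + \sum_i y 0 i.
have Lc : continuous L.
  move=> y; apply: differentiable_continuous; apply: differentiableD.
    by apply: differentiableM => //; exact: differentiable_coord.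
  rewrite -fct_sumE; apply: differentiable_sum => i.
  exact: differentiable_coord.
have : nbhs x [set y | L y < 0].
  by have := Lc x => /cvgr_lt /(_ 0 xneg).
move=> /cx[y [Gy]] /=; rewrite ltNge; move/negP; apply.
exact: cone_spike_support.
Qed.

End Cones.

(** * Directional derivatives *)

Section Directional.
Variables (R : realType).

Lemma line_growth (V W : normedModType R) (f : V -> W) (x v : V) (t : R) :
  (fun h : R => h^-1 *: ((fun s => f (x + s *: v)) (h *: (1 : R) + t) -
     (fun s => f (x + s *: v)) t)) =
  (fun h : R => h^-1 *: (f (h *: v + (x + t *: v)) - f (x + t *: v))).
Proof.
apply/funext => h /=; congr (_ *: (f _ - _)).
by rewrite [h *: (1 : R)]mulr1 scalerDl addrCA.
Qed.

Lemma is_derive_line (V W : normedModType R) (f : V -> W) (x v : V) (t : R) d :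
  is_derive (x + t *: v) v f d ->
  is_derive t (1 : R) (fun s => f (x + s *: v)) d.
Proof.
case=> df <-; split; first by rewrite /derivable line_growth.
by rewrite /derive line_growth.
Qed.

Lemma is_derive_line0 (V W : normedModType R) (f : V -> W) (x v : V) d :
  is_derive (0 : R) (1 : R) (fun s => f (x + s *: v)) d -> is_derive x v f d.
Proof.
case=> df <-; split; move: df; rewrite /derivable /derive line_growth;
  by rewrite scale0r addr0.
Qed.

Lemma is_derive_comp_real (V : normedModType R) (f : V -> R) (g : R -> R)
    (x v : V) (a b : R) :
  is_derive (f x) 1 g a -> is_derive x v f b ->
  is_derive x v (fun z => g (f z)) (a * b).
Proof.
move=> dg df; apply: is_derive_line0.
apply: (@is_derive1_comp R g (fun s => f (x + s *: v))).
  by rewrite scale0r addr0.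
by apply: is_derive_line; rewrite scale0r addr0.
Qed.

Lemma is_derive_inv (V : normedModType R) (f : V -> R) (x v : V) (b : R) :
  f x != 0 -> is_derive x v f b ->
  is_derive x v (fun z => (f z)^-1) (- (f x) ^- 2 * b).
Proof.
move=> fx0 df; apply: (is_derive_comp_real (g := fun y => y^-1)) => //.
apply: (is_derive_eq (@is_deriveV R id (f x) 1 1 fx0 _)).
by rewrite /= /GRing.scale /= mulr1.
Qed.

Lemma is_derive_coord m n (x v : 'M[R]_(m, n)) i j :
  is_derive x v (fun z : 'M[R]_(m, n) => z i j) (v i j).
Proof.
have [di vi] := @is_derive_id R _ x v.
have di' : forall i j, derivable (fun z : 'M[R]_(m, n) => z i j) x v.
  by apply/derivable_mxP; exact: di.
split; first exact: di'.
by have := derive_mx di; rewrite vi => /matrixP /(_ i j); rewrite mxE.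
Qed.

Lemma derive_pd m (f : 'rV[R]_m -> R) (x v : 'rV[R]_m) : differentiable f x ->
  'D_v f x = \sum_(i < m) v 0 i * pd i f x.
Proof.
move=> df; rewrite deriveE // {1}[v]row_sum_delta linear_sum /=.
by apply: eq_bigr => i _; rewrite linearZ /= /pd deriveE.
Qed.

Lemma is_derive_sum_fun m (V : normedModType R) (F : 'I_m -> V -> R) (x v : V)
    (d : 'I_m -> R) :
  (forall i, is_derive x v (F i) (d i)) ->
  is_derive x v (fun z => \sum_(i < m) F i z) (\sum_(i < m) d i).
Proof. by move=> h; rewrite -fct_sumE; apply: is_derive_sum. Qed.

Lemma is_derive_edotl m (q x v : 'rV[R]_m) :
  is_derive x v (fun z => edot z q) (edot v q).
Proof.
apply: is_derive_sum_fun => i.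
have := is_derive_coord x v 0 i => h.
by apply: (is_derive_eq (is_deriveM h (is_derive_cst (q 0 i) x v)));
  rewrite /GRing.scale /= mulr0 add0r mulrC.
Qed.

Lemma is_derive_edot2 m (x v : 'rV[R]_m) :
  is_derive x v (fun z => edot z z) (2 * edot x v).
Proof.
rewrite /edot mulr_sumr; apply: is_derive_sum_fun => i.
have h := is_derive_coord x v 0 i.
by apply: (is_derive_eq (is_deriveM h h)); rewrite /GRing.scale /=; ring.
Qed.

Lemma differentiable_edotl m (q x : 'rV[R]_m) :
  differentiable (fun z : 'rV[R]_m => edot z q) x.
Proof.
rewrite /edot -fct_sumE; apply: differentiable_sum => i.
by apply: differentiableM => //; exact: differentiable_coord.
Qed.

Lemma differentiable_edot2 m (x : 'rV[R]_m) :
  differentiable (fun z : 'rV[R]_m => edot z z) x.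
Proof.
rewrite /edot -fct_sumE; apply: differentiable_sum => i.
by apply: differentiableM; exact: differentiable_coord.
Qed.

Lemma edot_ge0 m (x : 'rV[R]_m) : 0 <= edot x x.
Proof. by apply: sumr_ge0 => i _; rewrite -expr2 sqr_ge0. Qed.

Lemma onePedot_gt0 m (x : 'rV[R]_m) : 0 < 1 + edot x x.
Proof. by have := edot_ge0 x; lra. Qed.

(** If [g2] were negative, [g1] would be negative just to the right of its zero, and the mean value
    theorem would push [g] below [g 0]. Differentiability of [g1] is asked at the single point 0. *)
Lemma local_min_second_order (g g1 : R -> R) (g2 d : R) : 0 < d ->
  (forall t : R, `|t| < d -> is_derive t (1 : R) g (g1 t)) ->
  is_derive (0 : R) (1 : R) g1 g2 ->
  (forall t, `|t| < d -> g 0 <= g t) -> g1 0 = 0 /\ 0 <= g2.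
Proof.
move=> d0 dg [dg1 dg1E] gmin.
have g10 : g1 0 = 0.
  have d00 : (0 : R) \in `]-d, d[ by rewrite in_itv /= oppr_lt0 d0.
  have := @derive1_at_min R g (-d) d 0 _ _ d00 _.
  have -> : -d <= d by lra.
  move=> /(_ isT) h.
  have /h : forall t, t \in `]-d, d[ -> derivable g t 1.
    by move=> t; rewrite in_itv /= -ltr_norml => /dg[].
  move=> /(_ _) k.
  have /k : forall t, t \in `]-d, d[ -> g 0 <= g t.
    by move=> t; rewrite in_itv /= -ltr_norml => /gmin.
  by case=> _ g0; have := dg 0; rewrite normr0 => /(_ d0)[_ <-].
split=> //; rewrite leNgt; apply/negP => g2neg.
have := dg1 => /cvg_ex[l hl].
have lE : l = g2 by rewrite -dg1E /derive; apply/esym/cvg_lim.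
have /nbhs_ballP[e /= e0 he] : \forall h \near (0 : R)^',
    h^-1 *: (g1 (h *: (1 : R) + 0) - g1 0) < 0.
  by apply: (cvgr_lt l) => //; rewrite lE.
pose h := Num.min e d / 2.
have h0 : 0 < h by rewrite divr_gt0 // lt_min e0 d0.
have hd : h < d.
  by have : Num.min e d <= d; [rewrite ge_min lexx orbT | rewrite /h; lra].
have hee : h < e.
  by have : Num.min e d <= e; [rewrite ge_min lexx | rewrite /h; lra].
have dgi : forall x, x \in `]0, h[ -> is_derive x 1 g (g1 x).
  move=> x; rewrite in_itv /= => /andP[x0 xh]; apply: dg.
  by rewrite gtr0_norm //; lra.
have [|c] := MVT h0 dgi.
  apply: derivable_within_continuous => x; rewrite in_itv /= => /andP[x0 xh].
  have : `|x| < d by rewrite ger0_norm //; lra.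
  by move=> /dg[].
rewrite in_itv /= => /andP[c0 ch] E.
have := gmin h; rewrite gtr0_norm // => /(_ hd).
apply/negP; rewrite -ltNge -subr_lt0 E subr0 pmulr_llt0 //.
have := he c; rewrite -ball_normE /ball_ /= sub0r normrN gtr0_norm //.
have ce : c < e by lra.
move=> /(_ ce); rewrite gt_eqF // => /(_ isT).
rewrite g10 subr0 addr0 [c *: _]mulr1 /GRing.scale /= pmulr_rlt0 //.
by rewrite invr_gt0.
Qed.

(** The mean value theorem is applied once, to the [v]-increment of [f] regarded as a function along
    [u]; the first-order expansion of ['D_u f] at [x] does the rest. *)
Lemma second_difference m (f : 'rV[R]_m -> R) (x u v : 'rV[R]_m) :
  (\forall y \near x, differentiable f y) ->
  differentiable ('D_u f) x ->
  forall e : R, 0 < e -> \forall h \near (0 : R)^'+,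
   `|f (x + h *: u + h *: v) - f (x + h *: u) - f (x + h *: v) + f x -
     h ^+ 2 * 'D_v ('D_u f) x| <= e * (h ^+ 2 * (`|u| + `|u| + `|v|)).
Proof.
move=> df dF e e0.
move: df => /nbhs_ballP[d /= d0 df].
have /eqaddoP /(_ e e0) /nbhs_ballP[d' /= d'0 hF] := diff_locally dF.
pose C := `|u| + `|v| + 1.
have C0 : 0 < C by rewrite /C; have := normr_ge0 u; have := normr_ge0 v; lra.
have bnd (h s t : R) : 0 < h -> h < Num.min d d' / C -> 0 <= s <= h -> 0 <= t <= h ->
    `|s *: u + t *: v| < Num.min d d'.
  move=> h0 hh /andP[s0 sh] /andP[t0 th].
  apply: (@le_lt_trans _ _ (h * (`|u| + `|v|))).
    rewrite (le_trans (ler_normD _ _)) // !normrZ !ger0_norm // mulrDr.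
    by rewrite lerD // ler_wpM2r.
  apply: (@le_lt_trans _ _ (h * C)); first by rewrite ler_pM2l // /C; lra.
  by rewrite -ltr_pdivlMr.
near=> h.
have h0 : 0 < h by near: h; exact: nbhs_right_gt.
have hh : h < Num.min d d' / C.
  by near: h; apply: nbhs_right_lt; rewrite divr_gt0 // lt_min d0 d'0.
have h1 : 0 <= h <= h by rewrite ltW //=.
have h2 : (0 : R) <= 0 <= h by rewrite lexx ltW.
pose g := fun t => f ((x + h *: v) + t *: u) - f (x + t *: u).
have dgi : forall t, 0 <= t <= h ->
    is_derive t 1 g ('D_u f ((x + h *: v) + t *: u) - 'D_u f (x + t *: u)).
  move=> t th; apply: is_deriveB.
    apply: is_derive_line; apply: derivableP; apply: diff_derivable; apply: df.
    rewrite -ball_normE /ball_ /= -addrA opprD addrA subrr sub0r normrN addrC.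
    by rewrite (lt_le_trans (bnd h t h _ _ _ _)) // ge_min lexx.
  apply: is_derive_line; apply: derivableP; apply: diff_derivable; apply: df.
  rewrite -ball_normE /ball_ /= opprD addrA subrr sub0r normrN.
  have := bnd h t 0 h0 hh th h2; rewrite scale0r addr0 => k.
  by rewrite (lt_le_trans k) // ge_min lexx.
have dgo t : t \in `]0, h[ ->
    is_derive t 1 g ('D_u f ((x + h *: v) + t *: u) - 'D_u f (x + t *: u)).
  by rewrite in_itv /= => /andP[t0 th]; apply: dgi; rewrite !ltW.
have cg : {within `[0, h], continuous g}.
  apply: derivable_within_continuous => t; rewrite in_itv /= => th.
  by have [] := dgi t th.
have [c cI E] := MVT h0 dgo cg.
have {}cI : 0 <= c <= h by move: cI; rewrite in_itv /= => /andP[? ?]; rewrite !ltW.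
have -> : f (x + h *: u + h *: v) - f (x + h *: u) - f (x + h *: v) + f x =
    g h - g 0.
  by rewrite /g !scale0r !addr0 (addrAC x (h *: v)); ring.
rewrite E subr0 expr2 -mulrA (mulrC (_ - _) h) -mulrBr normrM gtr0_norm //.
rewrite -mulrA [e * (h * _)]mulrCA ler_pM2l //.
have est w : `|w| < Num.min d d' ->
    `|'D_u f (w + x) - ('D_u f x + 'd ('D_u f) x w)| <= e * `|w|.
  move=> wd; have := hF w; rewrite -ball_normE /ball_ /= sub0r normrN.
  by apply; rewrite (lt_le_trans wd) // ge_min lexx orbT.
have lin a b : 'd ('D_u f) x (a *: u + b *: v) =
    a * 'd ('D_u f) x u + b * 'd ('D_u f) x v :> R.
  by rewrite linearD !linearZ.
have := est (c *: u + h *: v) (bnd h c h h0 hh cI h1).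
have := est (c *: u + 0 *: v) (bnd h c 0 h0 hh cI h2).
rewrite !lin (deriveE v dF) scale0r addr0.
rewrite [c *: u + x]addrC (_ : c *: u + h *: v + x = x + h *: v + c *: u); last first.
  by rewrite addrC [c *: u + _]addrC addrA.
set F1 := 'D_u f (x + c *: u); set F2 := 'D_u f (x + h *: v + c *: u).
set F0 := 'D_u f x; set A := c * _; set B := ('d _ x : _ -> _) v.
move=> k1 k2.
(* The expansion is used at [x + c u + h v] and at [x + c u] with [0 <= c <= h]; the two errors
   together produce the factor [|u| + |u| + |v|]. *)
have -> : F2 - F1 - h * B = (F2 - (F0 + (A + h * B))) - (F1 - (F0 + (A + 0 * B))).
  by ring.
rewrite (le_trans (ler_normB _ _)) // (le_trans (lerD k2 k1)) // -mulrDr.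
rewrite ler_pM2l // mulrDr; have ch : c <= h by case/andP: cI.
have c0 : 0 <= c by case/andP: cI.
have hu : c * `|u| <= h * `|u| by rewrite ler_wpM2r.
have : `|c *: u + h *: v| <= c * `|u| + h * `|v|.
  by rewrite (le_trans (ler_normD _ _)) // !normrZ !ger0_norm // ltW.
have : `|c *: u| = c * `|u| by rewrite normrZ ger0_norm.
by move=> -> ?; lra.
Unshelve. all: by end_near.
Qed.

(** The second difference is symmetric in [u] and [v], and both mixed derivatives are its limit
    after division by [h ^+ 2]. *)
Lemma derive_swap m (f : 'rV[R]_m -> R) (x u v : 'rV[R]_m) :
  (\forall y \near x, differentiable f y) ->
  differentiable ('D_u f) x -> differentiable ('D_v f) x ->
  'D_v ('D_u f) x = 'D_u ('D_v f) x.
Proof.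
move=> df du dv; apply/eqP; rewrite -subr_eq0 -normr_le0.
apply/ler_addgt0Pr => e e0; rewrite add0r.
pose C := (`|v| + `|v| + `|u|) + (`|u| + `|u| + `|v|) + 1.
have C0 : 0 < C by rewrite /C; have := normr_ge0 u; have := normr_ge0 v; lra.
have eC : 0 < e / C by rewrite divr_gt0.
have [h [[/= k2 k1] h0]] := filter_ex (@filterI _ _ _ _ _ (@filterI _ _ _ _ _
  (second_difference v df du eC) (second_difference u df dv eC))
  (nbhs_right_gt (0 : R))).
move: k1 k2; rewrite (addrAC x (h *: v)); set a := f x.
set b := f (_ + _ + _); set c := f (x + _ *: v); set d := f (x + _ *: u).
set A := 'D_u ('D_v f) x; set B := 'D_v ('D_u f) x.
move=> k1 k2.
rewrite -(ler_pM2l (exprn_gt0 2 h0)) -{1}(gtr0_norm (exprn_gt0 2 h0)) -normrM.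
have -> : h ^+ 2 * (B - A) =
  (b - c - d + a - h ^+ 2 * A) - (b - d - c + a - h ^+ 2 * B) by ring.
rewrite (le_trans (ler_normB _ _)) // (le_trans (lerD k1 k2)) //.
rewrite -mulrDr -mulrDr mulrCA ler_pM2l ?exprn_gt0 // -mulrA.
by rewrite ger_pMr // mulrC ler_pdivrMr // mul1r /C lerDl ler01.
Qed.

End Directional.

(** * The metric in the stereographic chart *)

(** The partial derivatives of the conformal exponent have an explicit formula only on the open set
    where the solution is regular; this transfers differentiability from the formula to them. *)
Lemma differentiable_near_eq (R : realType) (V W : normedModType R)
    (f g : V -> W) (x : V) :
  (\forall y \near x, f y = g y) -> differentiable f x -> differentiable g x.
Proof.
move=> fg dfx; have [cf ef] := (diff_locallyP x f).1 dfx.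
have eg : g \o shift x = cst (g x) + 'd f x +o_ (0 : V) id.
  apply/eqaddoP => e e0.
  move: ef => /eqaddoP /(_ e e0).
  apply: filterS2; last first.
    move: fg; rewrite (near_shift 0 x) => fg; exact: fg.
  move=> h /=; rewrite subr0 => fgh; rewrite -[in X in _ -> X](nbhs_singleton fg).
  by rewrite -![(_ - _ : _ -> _) _]/(_ - _) /= fgh.
apply/diff_locallyP.
by rewrite (diff_unique cf eg).
Qed.

Section Pointwise.
Variables (R : realType) (V : normedModType R) (x v : V).
Implicit Types (f g : V -> R) (a b c : R).

Lemma is_derive_add f g a b : is_derive x v f a -> is_derive x v g b ->
  is_derive x v (fun z => f z + g z) (a + b).
Proof. by move=> df dg; exact: is_deriveD. Qed.

Lemma is_derive_sub f g a b : is_derive x v f a -> is_derive x v g b ->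
  is_derive x v (fun z => f z - g z) (a - b).
Proof. by move=> df dg; exact: is_deriveB. Qed.

Lemma is_derive_addl f a c : is_derive x v f a ->
  is_derive x v (fun z => c + f z) a.
Proof.
move=> df; have h := is_deriveD (is_derive_cst c x v) df.
by apply: (is_derive_eq h); rewrite add0r.
Qed.

Lemma is_derive_scale f a c : is_derive x v f a ->
  is_derive x v (fun z => c * f z) (c * a).
Proof. by move=> df; exact: (is_deriveZ c df). Qed.

Lemma is_derive_mul f g a b : is_derive x v f a -> is_derive x v g b ->
  is_derive x v (fun z => f z * g z) (f x * b + g x * a).
Proof. by move=> df dg; exact: (is_deriveM df dg). Qed.

End Pointwise.

Section Chart.
Variables (R : realType) (m : nat).
Implicit Types (rho : 'rV[R]_m.+1 -> R) (y z : 'rV[R]_m).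

Lemma sum_delta (i : 'I_m) (F : 'I_m -> R) : \sum_k (k == i)%:R * F k = F i.
Proof.
rewrite (bigD1 i) //= eqxx mul1r big1 ?addr0 // => k /negbTE ->.
by rewrite mul0r.
Qed.

Lemma evecE (i j : 'I_m) : (evec i : 'rV[R]_m) 0 j = (j == i)%:R.
Proof. by rewrite mxE eqxx. Qed.

Lemma edotC (x y : 'rV[R]_m) : edot x y = edot y x.
Proof. by apply: eq_bigr => i _; rewrite mulrC. Qed.

Lemma edot_evec (y : 'rV[R]_m) (i : 'I_m) : edot y (evec i) = y 0 i.
Proof.
by rewrite -[RHS](sum_delta i (fun k => y 0 k)); apply: eq_bigr => k _;
  rewrite evecE mulrC.
Qed.

Lemma stereo_lift y (j : 'I_m) :
  stereo y 0 (lift ord_max j) = 2 * y 0 j / (1 + edot y y).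
Proof. by rewrite mxE liftK. Qed.

Lemma stereo_max y : stereo y 0 ord_max = (1 - edot y y) / (1 + edot y y).
Proof. by rewrite mxE unlift_none. Qed.

Lemma is_derive_onePedot y v :
  is_derive y v (fun z : 'rV[R]_m => 1 + edot z z) (2 * edot y v).
Proof. by apply: is_derive_addl; exact: is_derive_edot2. Qed.

Lemma is_derive_inv_onePedot y v :
  is_derive y v (fun z : 'rV[R]_m => (1 + edot z z)^-1)
    (- (1 + edot y y) ^- 2 * (2 * edot y v)).
Proof.
apply: (@is_derive_inv R _ (fun z : 'rV[R]_m => 1 + edot z z)).
  by rewrite gt_eqF // onePedot_gt0.
exact: is_derive_onePedot.
Qed.

Lemma is_derive_stereo_lift y (i j : 'I_m) :
  is_derive y (evec i) (fun z => stereo z 0 (lift ord_max j))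
   (2 * (j == i)%:R / (1 + edot y y) - 4 * y 0 i * y 0 j / (1 + edot y y) ^+ 2).
Proof.
have N0 : 1 + edot y y != 0 by rewrite gt_eqF // onePedot_gt0.
rewrite (_ : (fun z => _) = (fun z : 'rV[R]_m => 2 * z 0 j * (1 + edot z z)^-1));
  last by apply/funext => z; rewrite stereo_lift.
have h := is_derive_mul (is_derive_scale 2 (is_derive_coord y (evec i) 0 j))
  (is_derive_inv_onePedot y (evec i)).
apply: (is_derive_eq h); rewrite edot_evec evecE.
by field.
Qed.

Lemma is_derive_stereo_max y (i : 'I_m) :
  is_derive y (evec i) (fun z => stereo z 0 ord_max)
   (- (4 * y 0 i / (1 + edot y y) ^+ 2)).
Proof.
have N0 : 1 + edot y y != 0 by rewrite gt_eqF // onePedot_gt0.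
rewrite (_ : (fun z => _) =
  (fun z : 'rV[R]_m => (1 + - 1 * edot z z) * (1 + edot z z)^-1)); last first.
  by apply/funext => z; rewrite stereo_max mulN1r.
have h := is_derive_mul
  (is_derive_addl 1 (is_derive_scale (- 1) (is_derive_edot2 y (evec i))))
  (is_derive_inv_onePedot y (evec i)).
apply: (is_derive_eq h); rewrite edot_evec.
by field.
Qed.

Lemma derive_stereo y (i : 'I_m) (k : 'I_m.+1) :
  ('D_(evec i) (@stereo R m) y) 0 k = 'D_(evec i) (fun z => stereo z 0 k) y.
Proof.
rewrite derive_mx ?mxE //; apply/derivable_mxP => a b; rewrite ord1.
case: (unliftP ord_max b) => [j ->|->].
  by have [] := is_derive_stereo_lift y i j.
by have [] := is_derive_stereo_max y i.
Qed.

Lemma edot_derive_stereo y (i j : 'I_m) :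
  edot ('D_(evec i) (@stereo R m) y) ('D_(evec j) (@stereo R m) y) =
  4 * (i == j)%:R / (1 + edot y y) ^+ 2.
Proof.
have hl k l : ('D_(evec k) (@stereo R m) y) 0 (lift ord_max l) = 
   2 * (l == k)%:R / (1 + edot y y) - 4 * y 0 k * y 0 l / (1 + edot y y) ^+ 2.
  by rewrite derive_stereo; have [_ ->] := is_derive_stereo_lift y k l.
have hm k : ('D_(evec k) (@stereo R m) y) 0 ord_max =
   - (4 * y 0 k / (1 + edot y y) ^+ 2).
  by rewrite derive_stereo; have [_ ->] := is_derive_stereo_max y k.
move: (hl i) (hl j) (hm i) (hm j).
move: ('D_(evec i) _ y) ('D_(evec j) _ y) => a b ai bj am bm.
rewrite {1}/edot (bigD1_ord ord_max) //= am bm.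
under eq_bigr => k _ do rewrite ai bj.
have N0' : 1 + edot y y != 0 by rewrite gt_eqF // onePedot_gt0.
set s := 1 + edot y y in N0' *.
(* Each Kronecker delta is isolated as a factor so that [sum_delta] applies; the remaining sum is
   |y|^2 = s - 1. *)
rewrite (eq_bigr (fun k =>
   (k == i)%:R * (4 * (k == j)%:R / s ^+ 2 - 8 * y 0 j * y 0 k / s ^+ 3) + (k == j)%:R * (- (8 * y 0 i * y 0 k / s ^+ 3)) +
   16 * y 0 i * y 0 j / s ^+ 4 * (y 0 k * y 0 k))); last first.
  by move=> k _; field.
rewrite !big_split /= !sum_delta -mulr_sumr -/(edot y y).
have -> : edot y y = s - 1 by rewrite /s; ring.
by field.
Qed.

(** The last two terms are the logarithm of the stereographic factor 2 / (1 + |z|^2), so this is the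
    exponent V of the metric relative to the flat one. *)
Definition confexp rho z := rho (stereo z) + ln 2 - ln (1 + edot z z).

Lemma gmetE rho y : gmet rho y = (expR (2 * confexp rho y))%:M.
Proof.
apply/matrixP => i j; rewrite !mxE edot_derive_stereo.
have N0 := onePedot_gt0 y; set s := 1 + edot y y in N0 *.
have -> : expR (2 * confexp rho y) = expR (2 * rho (stereo y)) * (4 / s ^+ 2).
  rewrite /confexp -/s mulrBr mulrDr !expRD -mulrA; congr (_ * _).
  by rewrite expRN !expRM_natl !lnK ?posrE //; ring.
by rewrite -mulr_natr; field; rewrite gt_eqF.
Qed.

Lemma ginvE rho y : ginv rho y = (expR (- (2 * confexp rho y)))%:M.
Proof. by rewrite /ginv gmetE invmx_scalar expRN. Qed.

Lemma pd_gmet rho y (i j l : 'I_m) : differentiable (confexp rho) y ->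
  pd i (fun z => gmet rho z j l) y =
  (j == l)%:R * (2 * pd i (confexp rho) y * expR (2 * confexp rho y)).
Proof.
move=> dV.
have dVi : is_derive y (evec i) (confexp rho) (pd i (confexp rho) y).
  by apply/derivableP/diff_derivable.
have dE : is_derive y (evec i) (fun z => expR (2 * confexp rho z))
    (expR (2 * confexp rho y) * (2 * pd i (confexp rho) y)).
  by apply: (is_derive_comp_real (is_derive_expR _)); exact: is_derive_scale.
rewrite /pd (_ : (fun z => _) = (j == l)%:R *: (fun z => expR (2 * confexp rho z))).
  have [_ ->] := is_deriveZ (j == l)%:R dE.
  by rewrite -/(pd i (confexp rho) y) /GRing.scale /=; ring.
by apply/funext => z; rewrite gmetE mxE -[expR _ *+ _]mulr_natl.
Qed.

(** The Christoffel symbols of exp (2V) |dy|^2 when [p] is dV. Being linear in [p], the same formula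
    also gives their derivatives, with second derivatives of V in place of [p]. *)
Definition christ (p : 'I_m -> R) (k i j : 'I_m) : R :=
  (k == j)%:R * p i + (k == i)%:R * p j - (i == j)%:R * p k.

Lemma christoffelE rho y k i j : differentiable (confexp rho) y ->
  christoffel rho k i j y = christ (fun a => pd a (confexp rho) y) k i j.
Proof.
move=> dV; rewrite /christoffel.
under eq_bigr => l _.
  rewrite !pd_gmet // ginvE mxE -[X in X * _]mulr_natl -mulrA (eq_sym k l).
  over.
rewrite sum_delta /christ.
set E := expR (2 * _).
rewrite expRN -/E; have E0 : E != 0 by rewrite gt_eqF // expR_gt0.
rewrite (eq_sym j k) (eq_sym i k); move: E E0 => E E0.
by move: (pd i _ _) (pd j _ _) (pd k _ _) => a b c; field.
Qed.

Lemma pd_christoffel rho y a k i j :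
  (\forall z \near y, differentiable (confexp rho) z) ->
  (forall b, differentiable (pd b (confexp rho)) y) ->
  pd a (christoffel rho k i j) y =
  christ (fun b => pd a (pd b (confexp rho)) y) k i j.
Proof.
move=> dV ddV; rewrite {1}/pd.
rewrite (near_eq_derive (g := (k == j)%:R *: pd i (confexp rho) +
   (k == i)%:R *: pd j (confexp rho) - (i == j)%:R *: pd k (confexp rho))); last first.
  by apply: filterS dV => z dVz; rewrite christoffelE.
have d b : is_derive y (evec a) (pd b (confexp rho)) (pd a (pd b (confexp rho)) y).
  by apply: derivableP; apply: diff_derivable.
by have [_ ->] := is_deriveB (is_deriveD (is_deriveZ (k == j)%:R (d i))
  (is_deriveZ (k == i)%:R (d j))) (is_deriveZ (i == j)%:R (d k)).
Qed.

Lemma sum_christ1 p l : \sum_k christ p k k l = m%:R * p l.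
Proof.
rewrite (eq_bigr (fun=> p l)) ?sumr_const ?card_ord ?mulr_natl // => k _.
rewrite /christ eqxx.
have [->|_] := eqVneq k l; rewrite ?eqxx /=; ring.
Qed.

Lemma sum_christ2 p i j : \sum_l p l * christ p l i j =
  2 * p i * p j - (i == j)%:R * \sum_l p l ^+ 2.
Proof.
rewrite (eq_bigr (fun l => (l == j)%:R * (p l * p i) + (l == i)%:R * (p l * p j)
   - (i == j)%:R * p l ^+ 2)); last by move=> l _; rewrite /christ; ring.
by rewrite sumrB big_split /= !sum_delta -mulr_sumr; ring.
Qed.

Lemma sum_christ3 p i j :
  \sum_k \sum_l christ p k j l * christ p l i k =
  (m%:R + 2) * p i * p j - 2 * ((i == j)%:R * \sum_l p l ^+ 2).
Proof.
rewrite (eq_bigr (fun k => p i * p j + (k == j)%:R *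
    (2 * p i * p k - (i == k)%:R * \sum_l p l ^+ 2) -
    p k * christ p j i k)); last first.
  move=> k _.
  rewrite (eq_bigr (fun l => (l == k)%:R * (p j * christ p l i k) +
    (k == j)%:R * (p l * christ p l i k) - (l == j)%:R * (p k * christ p l i k))).
    rewrite sumrB big_split /= !sum_delta -mulr_sumr sum_christ2.
    congr (_ + _ - _); rewrite /christ eqxx.
    have [->|ik] := eqVneq i k; rewrite ?eqxx ?(eq_sym k i) ?(negbTE ik) /=; ring.
  by move=> l _; rewrite {1}/christ (eq_sym k l) (eq_sym j l); ring.
rewrite sumrB big_split /= sumr_const card_ord sum_delta -mulr_natl.
rewrite (_ : \sum_k p k * christ p j i k = (i == j)%:R * \sum_l p l ^+ 2); last first.
  rewrite (eq_bigr (fun k => (k == j)%:R * (p k * p i) + (i == j)%:R * p k ^+ 2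
    - (k == i)%:R * (p k * p j))).
    by rewrite sumrB big_split /= !sum_delta -mulr_sumr; ring.
  by move=> k _; rewrite /christ (eq_sym j k) (eq_sym i k) (eq_sym j i); ring.
by ring.
Qed.

Lemma sum_split4 (A B C D : 'I_m -> R) : \sum_k (A k - B k + (C k - D k)) =
  \sum_k A k - \sum_k B k + (\sum_k C k - \sum_k D k).
Proof. by rewrite big_split /= !sumrB. Qed.

Lemma sum_christ4 (h : 'I_m -> 'I_m -> R) i j : \sum_k christ (h k) k i j =
  h j i + h i j - (i == j)%:R * \sum_k h k k.
Proof.
rewrite (eq_bigr (fun k => (k == j)%:R * h k i + (k == i)%:R * h k j -
  (i == j)%:R * h k k)); last by [].
by rewrite sumrB big_split /= !sum_delta -mulr_sumr.
Qed.

Lemma sum_christ5 p i : \sum_k christ p k i k = m%:R * p i.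
Proof.
rewrite (eq_bigr (fun=> p i)) ?sumr_const ?card_ord ?mulr_natl // => k _.
rewrite /christ eqxx (eq_sym i k).
by have [->|_] := eqVneq k i; rewrite ?eqxx /=; ring.
Qed.

(** The conformal change formula for the Ricci tensor of a flat metric, reduced to an identity
    between arrays [p] of first and [h] of second derivatives. *)
Lemma ricci_algebra (p : 'I_m -> R) (h : 'I_m -> 'I_m -> R) i j :
  h j i = h i j ->
  \sum_k (christ (h k) k i j - christ (h j) k i k +
    (\sum_l christ p k k l * christ p l i j -
     \sum_l christ p k j l * christ p l i k)) =
  (m%:R - 2) * (p i * p j - h i j) -
  (i == j)%:R * (\sum_k h k k + (m%:R - 2) * \sum_k p k ^+ 2).
Proof.
move=> hs.
rewrite (sum_split4 (fun k => christ (h k) k i j) (fun k => christ (h j) k i k)).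
rewrite sum_christ3 sum_christ4 sum_christ5.
have -> : \sum_k \sum_l christ p k k l * christ p l i j =
    m%:R * (2 * p i * p j - (i == j)%:R * \sum_l p l ^+ 2).
  rewrite exchange_big /= -sum_christ2 mulr_sumr; apply: eq_bigr => l _.
  by rewrite -mulr_suml sum_christ1 mulrA.
by rewrite hs; ring.
Qed.

Section At.
Variables (rho : 'rV[R]_m.+1 -> R) (y : 'rV[R]_m).
Hypothesis dV : \forall z \near y, differentiable (confexp rho) z.
Hypothesis ddV : forall b, differentiable (pd b (confexp rho)) y.
Let p i := pd i (confexp rho) y.
Let H i j := pd i (pd j (confexp rho)) y.

Lemma hess_sym i j : H i j = H j i.
Proof. by apply: derive_swap => //; exact: ddV. Qed.

Lemma ricciE i j : ricci rho y i j = (m%:R - 2) * (p i * p j - H i j) -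
  (i == j)%:R * (\sum_k H k k + (m%:R - 2) * \sum_k p k ^+ 2).
Proof.
have dVy : differentiable (confexp rho) y by exact: nbhs_singleton dV.
rewrite -(ricci_algebra p (hess_sym j i)).
rewrite mxE; apply: eq_bigr => k _; rewrite !pd_christoffel //.
congr (_ + _); rewrite -sumrB; apply: eq_bigr => l _.
by rewrite !christoffelE.
Qed.

Definition schoutenV : 'M[R]_m :=
  \matrix_(i, j) (p i * p j - H i j - (i == j)%:R * ((\sum_k p k ^+ 2) / 2)).

Hypothesis m3 : (3 <= m)%N.

(** The Laplacian terms of the Ricci and scalar curvatures cancel in the Schouten combination,
    leaving coefficients that do not involve the dimension. *)
Lemma schEndE : schEnd rho y = expR (- (2 * confexp rho y)) *: schoutenV.
Proof.
have m3' : 3 <= m%:R :> R by rewrite ler_nat.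
rewrite /schEnd ginvE mul_scalar_mx; congr (_ *: _).
apply/matrixP => i j; rewrite [LHS]mxE.
rewrite [in LHS]mxE (ricciE i j) mxE [in LHS]mxE gmetE mxE.
set E := expR (2 * _).
have E0 : E != 0 by rewrite gt_eqF // expR_gt0.
rewrite (_ : scal rho y = E^-1 * ((m%:R - 2) * (\sum_k p k ^+ 2 - \sum_k H k k) -
   m%:R * (\sum_k H k k + (m%:R - 2) * \sum_k p k ^+ 2))); last first.
  rewrite /scal (eq_bigr (fun i => E^-1 * ricci rho y i i)).
    rewrite -mulr_sumr; congr (_ * _).
    under eq_bigr do rewrite ricciE eqxx mul1r.
    by rewrite sumrB -mulr_sumr sumrB sumr_const card_ord mulr_natl.
  move=> k _; rewrite -[RHS](sum_delta k (fun l => E^-1 * ricci rho y k l)).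
  apply: eq_bigr => l _; rewrite ginvE mxE expRN -/E -[X in X * _]mulr_natl.
  by rewrite (eq_sym k l) mulrA.
rewrite -[E *+ _]mulr_natr [RHS]mxE.
move: (\sum_k p k ^+ 2) (\sum_k H k k) (p i) (p j) (H i j) => S T a b c.
move: E E0 ((i == j)%:R : R) (m%:R : R) m3' => E E0 d M M3.
by field; rewrite E0 /= !gt_eqF //; lra.
Qed.

End At.
End Chart.

(** * From bounds on a quadratic form to the position of its eigenvalues in the cone, and back *)

Section EigenvaluesInCone.
Variables (R : realType) (m : nat) (Gam : set 'rV[R]_m).
Hypothesis Gopen : open Gam.
Hypothesis Gconv : forall a b (t : R), Gam a -> Gam b -> 0 <= t <= 1 ->
  Gam (t *: a + (1 - t) *: b).
Hypothesis Gcone : forall (t : R) a, 0 < t -> Gam a -> Gam (t *: a).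
Hypothesis Gsym : forall (s : 'S_m) a, Gam a -> Gam (col_perm s a).
Hypothesis Gpos : [set x : 'rV[R]_m | forall i, 0 < x 0 i] `<=` Gam.
Hypothesis Gsum : Gam `<=` [set x : 'rV[R]_m | 0 < \sum_(i < m) x 0 i].
Variables (A : 'M[R]_m) (lam : 'rV[R]_m).
Hypothesis Asym : A^T = A.
Hypothesis Alam : eigenvalues_are A lam.

Lemma qform_evec i : qform A (evec i) = A i i.
Proof.
rewrite /qform (eq_bigr (fun k => (k == i)%:R * \sum_j (j == i)%:R * A k j)).
  by rewrite !sum_delta.
move=> k _; rewrite mulr_sumr; apply: eq_bigr => j _; rewrite !evecE.
by ring.
Qed.

Lemma sum_eigenvalues : \sum_k lam 0 k = \tr A.
Proof.
have [X [Y [XY1 _ _ qA]]] := spectral_resolution Asym Alam.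
rewrite /mxtrace [RHS](eq_bigr (fun i => \sum_k lam 0 k * (X k i ^+ 2 + Y k i ^+ 2))).
  rewrite [RHS]exchange_big /=; apply: eq_bigr => k _.
  rewrite -mulr_sumr big_split /= -[LHS]mulr1 -(XY1 k).
  congr (_ * (_ + _)); apply: eq_bigr => i _;
  by rewrite !mxE expr2.
move=> i _; rewrite -qform_evec qA; apply: eq_bigr => k _.
by rewrite !edot_evec !mxE.
Qed.

(** In an eigenbasis the right-hand side is the sum of w_k ((m - 2) lam_k + sum lam), where the
    weights w_k >= 0 are the squared components of [z]; each bracket is nonnegative by the support
    inequality of the cone. *)
Lemma qform_ge_of_closure (j0 : 'I_m) z : (3 <= m)%N ->
  ~ Gam (spike 2 j0) -> closure Gam lam ->
  0 <= (m%:R - 2) * qform A z + edot z z * \tr A.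
Proof.
move=> m3 nG clam.
have [X [Y [_ _ w1 qA]]] := spectral_resolution Asym Alam.
rewrite -sum_eigenvalues qA -w1 mulr_sumr mulr_suml -big_split /=.
apply: sumr_ge0 => k _.
have nGk : ~ Gam (spike 2 k) by move=> Gk; apply: nG; exact: cone_spike_sym Gk.
have := closure_spike_support Gopen Gconv Gcone Gsym Gpos Gsum m3 nGk clam.
move=> h; set u := _ + edot (row k Y) z ^+ 2.
have u0 : 0 <= u by rewrite addr_ge0 // sqr_ge0.
have := mulr_ge0 u0 h; move: (\sum_i _) (lam 0 k) u {u0 h} => s l u.
by move: (m%:R : R) => M; lra.
Qed.

(** No min-max principle is involved: [lam] is compared entrywise with the diagonal of sig I - tau z
    z^T in an eigenbasis of [A]. That diagonal has entries sig - tau w_k with sum w_k = |z|^2, so it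
    is a nonnegative combination of the vectors [spike d k] for d = tau |z|^2 / sig <= c. *)
Lemma eigenvalues_in_cone (j0 : 'I_m) z (c sig tau : R) :
  Gam (spike c j0) -> 0 < sig -> 0 < edot z z -> tau * edot z z <= c * sig ->
  (forall x, sig * edot x x - tau * edot x z ^+ 2 <= qform A x) -> Gam lam.
Proof.
move=> Gc sig0 z0 tauc Age.
have [X [Y [XY1 lamE w1 _]]] := spectral_resolution Asym Alam.
pose w k := edot (row k X) z ^+ 2 + edot (row k Y) z ^+ 2.
have w0 k : 0 <= w k by rewrite addr_ge0 // sqr_ge0.
have ws : \sum_k w k = edot z z by exact: w1.
pose d := tau * edot z z / sig.
have dc : d <= c by rewrite ler_pdivrMr.
have Gd k : Gam (spike d k).
  apply: (cone_spike_sym Gsym (j := j0)).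
  exact: (cone_spike_le Gopen Gconv Gcone Gpos Gc).
have : Gam (\sum_k (sig / edot z z * w k) *: spike d k).
  apply: (cone_sum Gconv Gcone) => //.
    by move=> k _; rewrite mulr_ge0 // divr_ge0 // ltW.
  by rewrite -mulr_sumr ws divfK // gt_eqF.
move=> /(cone_le Gopen Gconv Gcone Gpos); apply => k.
have -> : (\sum_k (sig / edot z z * w k) *: spike d k) 0 k = sig - tau * w k.
  rewrite summxE (eq_bigr (fun i => sig / edot z z * w i -
      (i == k)%:R * (d * (sig / edot z z) * w i))); last first.
    by move=> i _; rewrite mxE spikeE (eq_sym k i); ring.
  rewrite sumrB -mulr_sumr ws sum_delta /d divfK ?gt_eqF //.
  by congr (_ - _); field; rewrite !gt_eqF.
rewrite lamE -[sig]mulr1 -(XY1 k).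
have := Age (row k X); have := Age (row k Y); rewrite /w.
by move: (edot _ z) (edot _ z) => a b; lra.
Qed.

End EigenvaluesInCone.

(** * Second order comparison *)

Section Comparison.
Variables (R : realType) (m : nat).
Implicit Types (V chi dchi : 'rV[R]_m -> R) (y z e q : 'rV[R]_m).

Definition hess V y e : R :=
  \sum_(i < m) \sum_(j < m) e 0 i * pd i (pd j V) y * e 0 j.

Lemma is_derive_hess V y e : (\forall z \near y, differentiable V z) ->
  (forall j, differentiable (pd j V) y) ->
  is_derive y e ('D_e V) (hess V y e).
Proof.
move=> dV ddV.
apply: (@near_eq_is_derive _ _ _ (fun z => \sum_j e 0 j * pd j V z)).
  by apply: filterS dV => z dVz; rewrite derive_pd.
rewrite /hess exchange_big /=; apply: is_derive_sum_fun => j.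
rewrite (_ : \sum_i _ = e 0 j * 'D_e (pd j V) y).
  by apply: is_derive_scale; apply/derivableP/diff_derivable.
rewrite derive_pd // mulr_sumr; apply: eq_bigr => i _.
by rewrite mulrC mulrA.
Qed.

(** The factor [s] covers contact from either side: it is 1 in the minimum principle and -1 at the
    maximum that rules out the spike. The proof restricts both functions to the line through [y]
    along [e]. *)
Lemma second_order_compare (s : R) V chi (chi1 : 'rV[R]_m -> R) y e c :
  (\forall z \near y, differentiable V z) ->
  (forall j, differentiable (pd j V) y) ->
  (\forall z \near y, is_derive z e chi (chi1 z)) ->
  is_derive y e chi1 c ->
  (\forall z \near y, s * (V y - chi y) <= s * (V z - chi z)) ->
  s * ('D_e V y - chi1 y) = 0 /\ 0 <= s * (hess V y e - c).
Proof.
move=> dV ddV dchi dchi1 ymin.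
have hV := is_derive_hess e dV ddV.
have /nbhs_ballP[r /= r0 hr] : \forall z \near y, [/\ differentiable V z,
    is_derive z e chi (chi1 z) & s * (V y - chi y) <= s * (V z - chi z)].
  by apply: filterS3 dV dchi ymin => z *; split.
pose d := r / (`|e| + 1).
have e1 : 0 < `|e| + 1 by rewrite ltr_wpDl.
have d0 : 0 < d by rewrite divr_gt0.
have inb t : `|t| < d -> ball y r (y + t *: e).
  move=> td; rewrite -ball_normE /ball_ /= opprD addrA subrr sub0r normrN normrZ.
  apply: (@le_lt_trans _ _ (`|t| * (`|e| + 1))).
    by rewrite ler_wpM2l // lerDl.
  by rewrite -ltr_pdivlMr.
have [||||E1 E2] := @local_min_second_order R
  (fun t => s * (V (y + t *: e) - chi (y + t *: e)))
  (fun t => s * ('D_e V (y + t *: e) - chi1 (y + t *: e)))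
  (s * (hess V y e - c)) d.
- exact: d0.
- move=> t /inb /hr[dVt dct _].
  apply: (is_derive_line (f := fun z => s * (V z - chi z))).
  apply: is_derive_scale.
  by apply: is_derive_sub => //; apply/derivableP/diff_derivable.
- apply: (is_derive_line (f := fun z => s * ('D_e V z - chi1 z))).
  by rewrite scale0r addr0; apply: is_derive_scale; apply: is_derive_sub.
- by move=> t /inb /hr[_ _]; rewrite scale0r addr0.
by move: E1; rewrite scale0r addr0.
Qed.

End Comparison.

(** * Barriers *)

Section Barrier.
Variables (R : realType) (m : nat).
Implicit Types (y z e q : 'rV[R]_m).

Definition hlog z : R := 2^-1 * ln (edot z z).

Lemma is_derive_hlog z e : 0 < edot z z ->
  is_derive z e hlog (edot z e / edot z z).
Proof.
move=> N0.
have h : is_derive z e (fun z => ln (edot z z)) ((edot z z)^-1 * (2 * edot z e)).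
  exact: (@is_derive_comp_real R _ (fun z : 'rV[R]_m => edot z z) (@ln R) z e
    _ _ (is_derive1_ln N0) (is_derive_edot2 z e)).
have {}h := is_derive_scale 2^-1 h.
by apply: (is_derive_eq h); field; rewrite gt_eqF.
Qed.

Lemma is_derive_inv_edot z e : 0 < edot z z ->
  is_derive z e (fun z => (edot z z)^-1) (- (edot z z) ^- 2 * (2 * edot z e)).
Proof.
move=> N0; apply: (@is_derive_inv R _ (fun z : 'rV[R]_m => edot z z)).
  by rewrite gt_eqF.
exact: is_derive_edot2.
Qed.

Lemma is_derive2_hlog z e : 0 < edot z z ->
  is_derive z e (fun z => edot z e / edot z z)
    (edot e e / edot z z - 2 * edot z e ^+ 2 / edot z z ^+ 2).
Proof.
move=> N0.
have h := is_derive_mul (is_derive_edotl e z e) (is_derive_inv_edot e N0).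
by apply: (is_derive_eq h); field; rewrite gt_eqF.
Qed.

Definition rquad (k c : R) z : R := k * ((edot z z - c) * (edot z z - c)).

Lemma is_derive_edotB (c : R) z e :
  is_derive z e (fun z => edot z z - c) (2 * edot z e).
Proof.
rewrite (_ : (fun z => _) = (fun z => - c + edot z z)).
  by apply: is_derive_addl; exact: is_derive_edot2.
by apply/funext => x; rewrite addrC.
Qed.

Lemma is_derive_rquad k c z e :
  is_derive z e (rquad k c) (4 * k * ((edot z z - c) * edot z e)).
Proof.
have d := is_derive_edotB c z e.
by apply: (is_derive_eq (is_derive_scale k (is_derive_mul d d))); ring.
Qed.

Lemma is_derive2_rquad k c z e :
  is_derive z e (fun z => 4 * k * ((edot z z - c) * edot z e))
    (8 * k * edot z e ^+ 2 + 4 * k * (edot z z - c) * edot e e).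
Proof.
have h := is_derive_scale (4 * k)
  (is_derive_mul (is_derive_edotB c z e) (is_derive_edotl e z e)).
by apply: (is_derive_eq h); ring.
Qed.

Definition rinv z : R := expR (- hlog z).

Lemma rinv_sqr z : 0 < edot z z -> rinv z ^+ 2 = (edot z z)^-1.
Proof.
move=> N0; rewrite /rinv /hlog -expRM_natl -[_ *+ 2]mulr_natl mulrN mulrA divff ?mul1r //.
by rewrite expRN lnK.
Qed.

Lemma is_derive_rinv z e : 0 < edot z z ->
  is_derive z e rinv (- (rinv z * (edot z e / edot z z))).
Proof.
move=> N0.
have h : is_derive z e (fun z => -1 * hlog z) (-1 * (edot z e / edot z z)).
  by apply: is_derive_scale; exact: is_derive_hlog.
rewrite (_ : rinv = fun z => expR (-1 * hlog z)); last first.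
  by apply/funext => x; rewrite mulN1r.
apply: (is_derive_eq (is_derive_comp_real (is_derive_expR _) h)).
by rewrite mulN1r; ring.
Qed.

(* A function on the cylinder must have critical points away from its minimum at
   [q]; the one of [bphi] is a saddle antipodal to [q], at which [exp (- al * bphi)]
   is still a strict subsolution when [k] is small. *)
Definition bphi (k c : R) q z : R := rquad k c z - edot z q * rinv z.

Definition bphi1 (k c : R) q e z : R := 4 * k * ((edot z z - c) * edot z e) -
  (edot z q * - (rinv z * (edot z e / edot z z)) + rinv z * edot e q).

Lemma is_derive_bphi k c q z e : 0 < edot z z ->
  is_derive z e (bphi k c q) (bphi1 k c q e z).
Proof.
move=> N0; apply: is_derive_sub; first exact: is_derive_rquad.
by apply: is_derive_mul; [exact: is_derive_edotl | exact: is_derive_rinv].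
Qed.

Definition bphi2 (k c : R) q e z : R :=
  8 * k * edot z e ^+ 2 + 4 * k * (edot z z - c) * edot e e +
  2 * edot e q * rinv z * edot z e / edot z z -
  3 * edot z q * rinv z * edot z e ^+ 2 / edot z z ^+ 2 +
  edot z q * rinv z * edot e e / edot z z.

Lemma is_derive2_bphi k c q z e : 0 < edot z z ->
  is_derive z e (bphi1 k c q e) (bphi2 k c q e z).
Proof.
move=> N0.
have dr := is_derive_rinv e N0.
have dm := is_derive_scale (-1) (is_derive_mul dr (is_derive2_hlog e N0)).
have h := is_derive_sub (is_derive2_rquad k c z e)
  (is_derive_add (is_derive_mul (is_derive_edotl q z e) dm)
     (is_derive_mul dr (is_derive_cst (edot e q) z e))).
rewrite (_ : bphi1 k c q e = fun z => 4 * k * ((edot z z - c) * edot z e) -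
  (edot z q * (-1 * (rinv z * (edot z e / edot z z))) + rinv z * cst (edot e q) z)).
  apply: (is_derive_eq h); rewrite /bphi2 /cst /=.
  by field; rewrite gt_eqF.
by apply/funext => x; rewrite /bphi1 mulN1r.
Qed.

Definition bpsi (al k c : R) q z : R := expR (- al * bphi k c q z).
Definition bpsi1 al k c q e z : R :=
  bpsi al k c q z * (- al * bphi1 k c q e z).

Lemma is_derive_bpsi al k c q z e : 0 < edot z z ->
  is_derive z e (bpsi al k c q) (bpsi1 al k c q e z).
Proof.
move=> N0; apply: (is_derive_comp_real (is_derive_expR _)).
by apply: is_derive_scale; exact: is_derive_bphi.
Qed.

Lemma is_derive2_bpsi al k c q z e : 0 < edot z z ->
  is_derive z e (bpsi1 al k c q e)
   (bpsi al k c q z * (al ^+ 2 * bphi1 k c q e z ^+ 2 - al * bphi2 k c q e z)).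
Proof.
move=> N0.
have h := is_derive_mul (is_derive_bpsi al k c q e N0)
  (is_derive_scale (- al) (is_derive2_bphi k c q e N0)).
by apply: (is_derive_eq h); rewrite /bpsi1; ring.
Qed.

Lemma edot_evec2 (i : 'I_m) : edot (evec i : 'rV[R]_m) (evec i) = 1.
Proof. by rewrite edot_evec evecE eqxx. Qed.

Lemma sum_quad y q (a b c d : R) :
  \sum_(i < m) (a * y 0 i ^+ 2 + b + c * (y 0 i * q 0 i) + d * q 0 i ^+ 2) =
  a * edot y y + b * m%:R + c * edot y q + d * edot q q.
Proof.
rewrite !big_split /= -!mulr_sumr sumr_const card_ord -[b *+ m]mulr_natr.
by congr (_ * _ + _ + _ + _ * _); apply: eq_bigr => i _; rewrite expr2.
Qed.

(** The operator takes a Hessian as a function of the direction, so that barriers enter through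
    their explicit second directional derivatives; [F = hess V y] gives |y|^2 Lap V + (m - 2) D^2
    V(y, y). *)
Definition ellop (F : 'rV[R]_m -> R) y : R :=
  edot y y * \sum_(i < m) F (evec i) + (m%:R - 2) * F y.

Lemma ellop_hlog y : 0 < edot y y ->
  ellop (fun e => edot e e / edot y y - 2 * edot y e ^+ 2 / edot y y ^+ 2) y = 0.
Proof.
move=> N0; rewrite /ellop.
rewrite (eq_bigr (fun i => (- (2 / edot y y ^+ 2)) * y 0 i ^+ 2 + (edot y y)^-1 +
   0 * (y 0 i * y 0 i) + 0 * y 0 i ^+ 2)).
  by rewrite sum_quad; field; rewrite gt_eqF.
by move=> i _; rewrite edot_evec2 edot_evec; field; rewrite gt_eqF.
Qed.

(** In cylindrical coordinates [bphi] is k (e^(2s) - c)^2 - <theta, q>. The factor of [al ^+ 2] is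
    its squared gradient for the symbol of the operator, with <theta, q> contributing 1 - <theta,
    q>^2, and the factor of [- al] is the operator applied to it. *)
Lemma ellop_bpsi al k c q y : 0 < edot y y -> edot q q = 1 ->
  ellop (fun e => bpsi al k c q y * (al ^+ 2 * bphi1 k c q e y ^+ 2 -
     al * bphi2 k c q e y)) y =
  bpsi al k c q y * (al ^+ 2 * ((m%:R - 1) * (4 * k * (edot y y * (edot y y - c))) ^+ 2
     + 1 - (edot y q * rinv y) ^+ 2) -
    al * ((m%:R - 1) * (8 * k * (edot y y * (2 * edot y y - c)) + edot y q * rinv y))).
Proof.
move=> N0 q1; have Nn0 : edot y y != 0 by rewrite gt_eqF.
have k2 := rinv_sqr N0.
have k2' : rinv y ^+ 2 * edot y y = 1 by rewrite k2 mulVf.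
rewrite /ellop /bphi1 /bphi2; set psi := bpsi _ _ _ _ _.
set r := rinv y in k2 k2' *; set b := edot y q; set N := edot y y in N0 Nn0 k2 k2' *.
pose u := 4 * k * (N - c) + b * r / N.
rewrite (eq_bigr (fun i =>
   (psi * (al ^+ 2 * u ^+ 2 - al * (8 * k - 3 * b * r / N ^+ 2))) * y 0 i ^+ 2 +
   psi * (- al) * (4 * k * (N - c) + b * r / N) +
   (psi * (- (2 * al ^+ 2 * u * r) - al * (2 * r / N))) * (y 0 i * q 0 i) +
   (psi * (al ^+ 2 * r ^+ 2)) * q 0 i ^+ 2)); last first.
  move=> i _; rewrite edot_evec2 edot_evec (edotC (evec i)) edot_evec /u.
  by field.
rewrite sum_quad q1 -/N -/b /u.
have NE : N = (r ^+ 2)^-1 by rewrite k2 invrK.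
have rn0 : r != 0 by rewrite gt_eqF // expR_gt0.
clear k2 k2' N0 Nn0 u; move: (m%:R : R) => M.
move: r b N psi NE rn0 => r b N psi -> rn0.
by field.
Qed.

(** The sign of [ellop] on the barrier with k = 1/32, after division by al psi. Here M = m - 1, [a]
    stands for the squared inner radius, N = |y|^2, and [x] is the cosine of the angle between y and
    the centre [q]. *)
Lemma barrier_pos (M a N c x eta : R) : 1 <= M -> 0 < a -> a <= N -> N <= 1 ->
  0 <= c -> c <= 1 -> -1 <= x -> x <= 1 -> 0 < eta -> eta <= 1 ->
  (eta <= `|N - c|) || (x <= 1 - eta) ->
  0 < 128 * M / (a ^+ 2 * eta ^+ 2) * (M * (8^-1 * (N * (N - c))) ^+ 2 + 1 - x ^+ 2)
     - M * (4^-1 * (N * (2 * N - c)) + x).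
Proof.
move=> M1 a0 aN N1 c0 c1 x1 x1' e0 e1 hB.
set al := 128 * M / _.
have M0 : 0 < M by lra.
have ae0 : 0 < a ^+ 2 * eta ^+ 2 by rewrite mulr_gt0 // exprn_gt0.
have al0 : 0 < al by rewrite divr_gt0 // mulr_gt0.
have alE : al * (a ^+ 2 * eta ^+ 2) = 128 * M by rewrite divfK // gt_eqF.
have N0 : 0 < N by lra.
have a1 : a <= 1 by lra.
have rhs : 4^-1 * (N * (2 * N - c)) <= 2^-1.
  have : N * (2 * N - c) <= 2 by nra.
  by lra.
have sq0 : 0 <= (8^-1 * (N * (N - c))) ^+ 2 by exact: sqr_ge0.
have x20 : 0 <= 1 - x ^+ 2 by nra.
have Msq : (8^-1 * (N * (N - c))) ^+ 2 <= M * (8^-1 * (N * (N - c))) ^+ 2.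
  by rewrite ler_peMl.
set T := M * _ ^+ 2 in Msq *; set Q := _ ^+ 2 in sq0 Msq.
have lhs0 : 0 <= al * (T + 1 - x ^+ 2) by apply: mulr_ge0; [exact: ltW | lra].
(* Near the antipode of the centre the gradient may vanish, but k = 1/32 keeps the radial
   second-order term at most 1/2, so the operator applied to [bphi] is at most -M/4 there. *)
have [x34|x34] := leP x (- (3 / 4)).
  have : M * (4^-1 * (N * (2 * N - c)) + x) <= M * (- 4^-1).
    by rewrite ler_pM2l //; lra.
  by lra.
have rhs2 : M * (4^-1 * (N * (2 * N - c)) + x) <= M * (3 / 2).
  by rewrite ler_pM2l //; lra.
(* With 128 = 2 * 64 this lower bound on the gradient contributes 2M, against at most 3M/2 from the
   operator. The gradient is radial when |N - c| >= eta, and angular when x <= 1 - eta, since 1 + x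
   >= 1/4 here. *)
suff : a ^+ 2 * eta ^+ 2 / 64 <= T + 1 - x ^+ 2.
  rewrite -(ler_pM2l al0) mulrA alE => h; lra.
have a2 : a ^+ 2 <= 1 by rewrite expr_le1 // ltW.
have a20 : 0 <= a ^+ 2 by exact: sqr_ge0.
have ee : 0 <= eta ^+ 2 by exact: sqr_ge0.
have ee1 : eta ^+ 2 <= eta by rewrite expr2 ger_pMr.
have aee : a ^+ 2 * eta ^+ 2 <= eta ^+ 2 by rewrite ler_piMl.
case/orP: hB => [Nc|xe].
  suff : a ^+ 2 * eta ^+ 2 / 64 <= Q by lra.
  have -> : Q = N ^+ 2 * `|N - c| ^+ 2 / 64 by rewrite real_normK ?num_real // /Q; field.
  rewrite ler_pM2r ?invr_gt0 // ler_pM // lerXn2r // ?nnegrE ?ltW //.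
have : eta * 4^-1 <= (1 - x) * (1 + x) by rewrite ler_pM //; lra.
by rewrite (_ : (1 - x) * (1 + x) = 1 - x ^+ 2); [lra | ring].
Qed.

End Barrier.

(** * The annulus *)

Section EdotAlgebra.
Variables (R : realType) (m : nat).
Implicit Types (x y z : 'rV[R]_m).

Lemma edotDl x y z : edot (x + y) z = edot x z + edot y z.
Proof. by rewrite /edot -big_split /=; apply: eq_bigr => i _; rewrite mxE mulrDl. Qed.

Lemma edotZl (c : R) x y : edot (c *: x) y = c * edot x y.
Proof. by rewrite /edot mulr_sumr; apply: eq_bigr => i _; rewrite mxE mulrA. Qed.

Lemma edotDr x y z : edot z (x + y) = edot z x + edot z y.
Proof. by rewrite edotC edotDl !(edotC z). Qed.

Lemma edotZr (c : R) x y : edot x (c *: y) = c * edot x y.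
Proof. by rewrite edotC edotZl edotC. Qed.

Lemma edot_Cauchy_Schwarz x y : 0 < edot x x ->
  edot x y ^+ 2 <= edot x x * edot y y.
Proof.
move=> x0; have := edot_ge0 (edot x x *: y + (- edot x y) *: x).
rewrite !(edotDl, edotDr, edotZl, edotZr) (edotC y x) => h.
rewrite -subr_ge0 -(pmulr_rge0 _ x0).
by move: h; set a := edot x x; set b := edot x y; set c := edot y y; lra.
Qed.

Lemma edot_lt_norm x (e : R) : 0 < e -> edot x x < e ^+ 2 -> `|x| < e.
Proof.
move=> e0 xe; rewrite /Num.Def.normr /= mx_normrE; apply/bigmax_ltP.
split=> // -[i j] _ /=; rewrite ord1.
rewrite -(@ltr_pXn2r _ 2) ?nnegrE //; last exact: ltW.
rewrite real_normK ?num_real //.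
apply: le_lt_trans xe; rewrite /edot (bigD1 j) //= -expr2 lerDl.
by apply: sumr_ge0 => k _; rewrite -expr2 sqr_ge0.
Qed.

End EdotAlgebra.

Lemma derive_sign (R : realType) (g : R -> R) (l : R) :
  is_derive (0 : R) (1 : R) g l -> l != 0 ->
  exists2 e : R, 0 < e &
    forall t, t != 0 -> `|t| < e -> 0 < l * (t^-1 * (g t - g 0)).
Proof.
move=> [dg dgE] l0.
have /cvg_ex[l' hl] := dg.
have lE : l' = l by rewrite -dgE /derive; apply/esym/cvg_lim.
rewrite lE in hl.
have ll : 0 < l * l by rewrite -expr2 exprn_even_gt0.
have /nbhs_ballP[e /= e0 he] : \forall h \near (0 : R)^',
    0 < l * (h^-1 *: (g (h *: (1 : R) + 0) - g 0)).
  apply: (cvgr_gt (l * l)) => //.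
  by apply: cvgMr; exact: hl.
exists e => // t t0 te; have := he t; rewrite -ball_normE /ball_ /= sub0r normrN.
by move=> /(_ te t0); rewrite [t *: _]mulr1 addr0.
Qed.

Section Annulus.
Variables (R : realType) (m : nat) (a : R).
Hypothesis a01 : 0 < a < 1.
Implicit Types (y z e q : 'rV[R]_m).

Definition annulus y : Prop := a ^+ 2 <= edot y y <= 1.

Let a0 : 0 < a. Proof. by case/andP: a01. Qed.
Let a1 : a < 1. Proof. by case/andP: a01. Qed.
Let a20 : 0 < a ^+ 2. Proof. by rewrite exprn_gt0. Qed.
Let a21 : a ^+ 2 < 1. Proof. by rewrite expr_lt1 // ltW. Qed.

Lemma annulus_gt0 y : annulus y -> 0 < edot y y.
Proof. by case/andP => h _; exact: lt_le_trans h. Qed.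

Lemma annulus_compact : compact annulus.
Proof.
apply: bounded_closed_compact.
  exists 2; split=> // M M2 y /andP[_ y1].
  apply: ltW; apply: lt_trans M2; apply: edot_lt_norm => //.
  by apply: le_lt_trans y1 _; rewrite expr2; lra.
rewrite (_ : annulus = (fun y : 'rV[R]_m => edot y y) @^-1` `[a ^+ 2, 1]).
  apply: preimage_closed; last exact: itv_closed.
  by move=> y _; apply: differentiable_continuous; exact: differentiable_edot2.
by apply/seteqP; split => y /=; rewrite in_itv.
Qed.

Lemma annulus_nonempty : (0 < m)%N -> annulus !=set0.
Proof.
move=> m0; exists (evec (Ordinal m0)); rewrite /annulus edot_evec2 lexx andbT.
exact: ltW.
Qed.

Lemma near_annulus y : a ^+ 2 < edot y y -> edot y y < 1 ->
  \forall z \near y, annulus z.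
Proof.
move=> ya y1.
have cN : {for y, continuous (fun z : 'rV[R]_m => edot z z)}.
  by apply: differentiable_continuous; exact: differentiable_edot2.
have n1 : \forall z \near y, edot z z < 1 by apply: (cvgr_lt _ cN).
have n2 : \forall z \near y, a ^+ 2 < edot z z by apply: (cvgr_gt _ cN).
by apply: filterS2 n1 n2 => z z1 z2; rewrite /annulus !ltW.
Qed.

Lemma annulus_interior_min (G : 'rV[R]_m -> R) : (0 < m)%N ->
  {within annulus, continuous G} ->
  (forall y, edot y y = 1 -> exists2 l : R, 0 < l & is_derive y y G l) ->
  (forall y, edot y y = a ^+ 2 -> exists2 l : R, l < 0 & is_derive y y G l) ->
  exists y, [/\ a ^+ 2 < edot y y, edot y y < 1 &
    forall z, annulus z -> G y <= G z].
Proof.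
move=> m0 cG G1 Ga.
have [y Ky ymin] := EVT_min_rV (annulus_nonempty m0) annulus_compact cG.
have {}ymin z : annulus z -> G y <= G z by move=> Kz; apply: ymin; rewrite inE.
have {Ky} /andP[ya y1] : annulus y by rewrite inE in Ky.
have scl (t : R) : y + t *: y = (1 + t) *: y by rewrite scalerDl scale1r.
have edt (t : R) : edot (y + t *: y) (y + t *: y) = (1 + t) ^+ 2 * edot y y.
  by rewrite scl edotZl edotZr mulrA -expr2.
have line l : is_derive y y G l ->
    is_derive (0 : R) (1 : R) (fun t => G (y + t *: y)) l.
  by move=> d; apply: is_derive_line; rewrite scale0r addr0.
exists y; split=> //.
- rewrite lt_neqAle ya andbT; apply/eqP => yE.
  have [l l0 dl] := Ga y (esym yE).
  have ln0 : l != 0 by rewrite lt_eqF.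
  have [e e0 he] := derive_sign (line l dl) ln0.
  (* The bound (1 + t) a <= 1 keeps the point moved outward inside the annulus; on the outer sphere
     the bound 1 - t >= a plays the same part for an inward move. *)
  pose t := Num.min e (a^-1 - 1) / 2.
  have ai : 1 < a^-1 by rewrite invf_gt1.
  have m0' : 0 < Num.min e (a^-1 - 1) by rewrite lt_min e0 subr_gt0.
  have t0 : 0 < t by rewrite divr_gt0.
  have me : Num.min e (a^-1 - 1) <= e by rewrite ge_min lexx.
  have ma : Num.min e (a^-1 - 1) <= a^-1 - 1 by rewrite ge_min lexx orbT.
  have te : `|t| < e by rewrite gtr0_norm // /t; lra.
  have ta : 1 + t <= a^-1 by rewrite /t; lra.
  have := he t (lt0r_neq0 t0) te; rewrite scale0r addr0.
  have : annulus (y + t *: y).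
    rewrite /annulus edt -yE; apply/andP; split.
      by apply: ler_peMl; [exact: ltW | apply: exprn_ege1; lra].
    rewrite -exprMn expr_le1 //; first by rewrite -ler_pdivlMr // mul1r.
    by apply: mulr_ge0; [lra | exact: ltW].
  move=> /ymin; rewrite -subr_ge0 => h.
  apply/negP; rewrite -leNgt; apply: mulr_le0_ge0; first exact: ltW.
  by rewrite mulr_ge0 // invr_ge0 ltW.
- rewrite lt_neqAle y1 andbT; apply/eqP => yE.
  have [l l0 dl] := G1 y yE.
  have ln0 : l != 0 by rewrite gt_eqF.
  have [e e0 he] := derive_sign (line l dl) ln0.
  pose t := Num.min e (1 - a) / 2.
  have m0' : 0 < Num.min e (1 - a) by rewrite lt_min e0 subr_gt0.
  have t0 : 0 < t by rewrite divr_gt0.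
  have me : Num.min e (1 - a) <= e by rewrite ge_min lexx.
  have ma : Num.min e (1 - a) <= 1 - a by rewrite ge_min lexx orbT.
  have te : `|- t| < e by rewrite normrN gtr0_norm // /t; lra.
  have tn0 : - t != 0 by rewrite oppr_eq0 gt_eqF.
  have at1 : a <= 1 - t by rewrite /t; lra.
  have := he (- t) tn0 te; rewrite scale0r addr0.
  have : annulus (y + - t *: y).
    rewrite /annulus edt yE mulr1; apply/andP; split.
      by rewrite !expr2; apply: ler_pM => //; exact: ltW.
    by rewrite expr_le1 //; have := a0; lra.
  move=> /ymin; rewrite -subr_ge0 => h.
  apply/negP; rewrite -leNgt; apply: mulr_ge0_le0; first exact: ltW.
  by apply: mulr_le0_ge0 => //; rewrite invr_le0 oppr_le0 ltW.
Qed.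

Lemma bphi1_radial k c q y : 0 < edot y y ->
  bphi1 k c q y y = 4 * k * (edot y y * (edot y y - c)).
Proof.
move=> N0; rewrite /bphi1 (edotC y q) divff ?gt_eqF //; ring.
Qed.

Lemma ellop_sub (d : R) (F H : 'rV[R]_m -> R) y :
  ellop (fun e => d * F e - H e) y = d * ellop F y - ellop H y.
Proof. by rewrite /ellop sumrB -mulr_sumr; ring. Qed.

Lemma le_ellop (F H : 'rV[R]_m -> R) y : (2 <= m)%N ->
  (forall e, F e <= H e) -> ellop F y <= ellop H y.
Proof.
move=> m2 FH; apply: lerD.
  by apply: ler_wpM2l; [exact: edot_ge0 | apply: ler_sum].
by apply: ler_wpM2l => //; rewrite subr_ge0 ler_nat.
Qed.

(** With s = |y|, s' = |z| and [x] the cosine of the angle, |y - z|^2 = (s - s')^2 + 2 s s' (1 - x),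
    and (s - s')^2 <= |s^2 - s'^2|. Caps described by radius and angle are thus small in the
    Euclidean norm. *)
Lemma dist_polar y z : 0 < edot y y <= 1 -> 0 < edot z z <= 1 ->
  edot y z * (rinv y * rinv z) <= 1 ->
  edot (y - z) (y - z) <= `|edot y y - edot z z| +
    2 * (1 - edot y z * (rinv y * rinv z)).
Proof.
move=> /andP[y0 y1] /andP[z0 z1]; set x := _ * _ => x1.
have -> : edot (y - z) (y - z) = edot y y + edot z z - 2 * edot y z.
  by rewrite -scaleN1r !(edotDl, edotDr, edotZl, edotZr) (edotC z y); ring.
pose s := (rinv y)^-1; pose s' := (rinv z)^-1.
have s0 : 0 < s by rewrite invr_gt0 expR_gt0.
have s'0 : 0 < s' by rewrite invr_gt0 expR_gt0.
have sE : edot y y = s ^+ 2 by rewrite exprVn rinv_sqr // invrK.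
have s'E : edot z z = s' ^+ 2 by rewrite exprVn rinv_sqr // invrK.
have xE : edot y z = x * (s * s').
  by rewrite /x /s /s'; field; rewrite !gt_eqF // expR_gt0.
rewrite xE sE s'E; rewrite sE in y0 y1; rewrite s'E in z0 z1.
have s1 : s <= 1 by rewrite -(expr_le1 (n := 2)) // ltW.
have s'1 : s' <= 1 by rewrite -(expr_le1 (n := 2)) // ltW.
have ss : s * s' * (1 - x) <= 1 * (1 - x).
  by rewrite ler_wpM2r ?subr_ge0 // mulr_ile1 // ltW.
have sd : (s - s') ^+ 2 <= `|s ^+ 2 - s' ^+ 2|.
  rewrite subr_sqr normrM -real_normK ?num_real // expr2 ler_wpM2l //.
  have -> : `|s + s'| = s + s' by rewrite ger0_norm // addr_ge0 // ltW.
  by rewrite ler_norml; apply/andP; split; lra.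
by move: ss sd; rewrite !expr2; lra.
Qed.

(** * The strong minimum principle under the Neumann condition *)

Section StrongMin.
Variable (V : 'rV[R]_m -> R).
Hypothesis m3 : (3 <= m)%N.
Hypothesis dV : forall y, annulus y -> \forall z \near y, differentiable V z.
Hypothesis ddV : forall y, annulus y -> forall j, differentiable (pd j V) y.
Hypothesis Lneg : forall y, annulus y -> ellop (hess V y) y <= 0.
Hypothesis neumann : forall y, edot y y = 1 \/ edot y y = a ^+ 2 ->
  'D_y V y = -1.

Let W y := V y + hlog y.

Lemma cont_hlog y : 0 < edot y y -> {for y, continuous (@hlog R m)}.
Proof.
move=> y0; apply: continuousM; first exact: cst_continuous.
apply: (@continuous_comp _ _ _ (fun z : 'rV[R]_m => edot z z) (@ln R)).
  by apply: differentiable_continuous; exact: differentiable_edot2.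
exact: continuous_ln.
Qed.

Lemma cont_W y : annulus y -> {for y, continuous W}.
Proof.
move=> Ky; apply: continuousD; last by apply: cont_hlog; exact: annulus_gt0.
by apply: differentiable_continuous; exact: nbhs_singleton (dV Ky).
Qed.

Lemma radial_W y : annulus y -> edot y y = 1 \/ edot y y = a ^+ 2 ->
  is_derive y y W 0.
Proof.
move=> Ky yb; have y0 := annulus_gt0 Ky.
have dVy : is_derive y y V (-1).
  rewrite -(neumann yb); apply/derivableP/diff_derivable.
  exact: nbhs_singleton (dV Ky).
apply: (is_derive_eq (is_derive_add dVy (is_derive_hlog y y0))).
by rewrite divff ?gt_eqF // addNr.
Qed.

Lemma cont_bpsi al k c q y : 0 < edot y y -> {for y, continuous (bpsi al k c q)}.
Proof.
move=> y0.
have cN : {for y, continuous (fun z : 'rV[R]_m => edot z z)}.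
  by apply: differentiable_continuous; exact: differentiable_edot2.
apply: (@continuous_comp _ _ _ (fun z => - al * bphi k c q z) (@expR R)); last first.
  exact: continuous_expR.
apply: continuousM; first exact: cst_continuous.
apply: continuousB.
  apply: continuousM; first exact: cst_continuous.
  by apply: continuousM; apply: continuousB => //; exact: cst_continuous.
apply: continuousM.
  by apply: differentiable_continuous; exact: differentiable_edotl.
apply: (@continuous_comp _ _ _ (fun z => - hlog z) (@expR R)); last first.
  exact: continuous_expR.
by apply: continuousN; exact: cont_hlog.
Qed.

(* A minimum is not on the boundary, where the radial derivative of [bpsi] has a
   strict sign, and not at an interior point outside the cap, where [bpsi] is a
   strict subsolution. *)
Lemma barrier_min_in_cap (q : 'rV[R]_m) (c eta de : R) (al := 128 * (m%:R - 1) /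
    ((a ^+ 2) ^+ 2 * eta ^+ 2)) :
  edot q q = 1 -> a ^+ 2 < c -> c < 1 -> 0 < eta -> eta <= 1 -> 0 < de ->
  exists y, [/\ annulus y, `|edot y y - c| < eta, 1 - eta < edot y q * rinv y &
    forall z, annulus z -> W y - de * bpsi al 32^-1 c q y <=
      W z - de * bpsi al 32^-1 c q z].
Proof.
move=> q1 ca c1 e0 e1 de0.
have m3' : 3 <= m%:R :> R by rewrite ler_nat.
have ae : 0 < (a ^+ 2) ^+ 2 * eta ^+ 2 by rewrite mulr_gt0 // exprn_gt0.
have al0 : 0 < al by rewrite /al divr_gt0 // mulr_gt0 //; lra.
pose psi := bpsi al 32^-1 c q.
have psi0 z : 0 < psi z by exact: expR_gt0.
have P0 z : 0 < de * psi z * al by apply: mulr_gt0 => //; apply: mulr_gt0.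
pose G z := W z - de * psi z.
have dG y : annulus y -> edot y y = 1 \/ edot y y = a ^+ 2 ->
    is_derive y y G (de * psi y * al * (8^-1 * (edot y y * (edot y y - c)))).
  move=> Ky yb; have y0 := annulus_gt0 Ky.
  have h := is_derive_sub (radial_W Ky yb)
    (is_derive_scale de (is_derive_bpsi al 32^-1 c q y y0)).
  apply: (is_derive_eq h); rewrite /bpsi1 bphi1_radial // -/psi.
  by rewrite sub0r; field.
have [||y y1 |y y1 |y [ya y1 ymin]] := @annulus_interior_min G.
- by apply: leq_trans m3.
- apply: continuous_in_subspaceT => y; rewrite inE => Ky.
  apply: continuousB; first exact: cont_W.
  apply: continuousM; first exact: cst_continuous.
  by apply: cont_bpsi; exact: annulus_gt0.
- have Ky : annulus y by rewrite /annulus y1 lexx ltW.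
  exists (de * psi y * al * (8^-1 * (edot y y * (edot y y - c)))).
    rewrite y1 mul1r; apply: mulr_gt0; first exact: P0.
    by apply: mulr_gt0; rewrite ?invr_gt0 // subr_gt0.
  by apply: dG => //; left.
- have Ky : annulus y by rewrite /annulus y1 lexx ltW.
  exists (de * psi y * al * (8^-1 * (edot y y * (edot y y - c)))).
    rewrite y1 (pmulr_rlt0 _ (P0 y)) pmulr_rlt0 ?invr_gt0 // pmulr_rlt0 //.
    by rewrite subr_lt0.
  by apply: dG => //; right.
have Ky : annulus y by rewrite /annulus !ltW.
have y0 := annulus_gt0 Ky.
exists y; suff : (`|edot y y - c| < eta) && (1 - eta < edot y q * rinv y).
  by case/andP.
rewrite -[_ && _]negbK negb_and -!leNgt; apply/negP => hB.
have r2 := rinv_sqr y0.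
have x2 : (edot y q * rinv y) ^+ 2 <= 1.
  rewrite exprMn r2 ler_pdivrMr // mul1r.
  by have := edot_Cauchy_Schwarz q y0; rewrite q1 mulr1.
have /andP[x1 x1'] : -1 <= edot y q * rinv y <= 1.
  by rewrite -ler_norml -(expr_le1 (n := 2)) // real_normK // num_real.
have M1 : 1 <= m%:R - 1 :> R by lra.
have := @barrier_pos R (m%:R - 1) (a ^+ 2) (edot y y) c (edot y q * rinv y) eta
  M1 a20 (ltW ya) (ltW y1) (ltW (lt_trans a20 ca)) (ltW c1) x1 x1' e0 e1 hB.
rewrite -/al => pos.
have chi1 z e : 0 < edot z z -> is_derive z e (fun z => de * psi z - hlog z)
    (de * bpsi1 al 32^-1 c q e z - edot z e / edot z z).
  move=> z0; apply: is_derive_sub; last exact: is_derive_hlog.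
  by apply: is_derive_scale; exact: is_derive_bpsi.
have Gchi z : 1 * (V z - (de * psi z - hlog z)) = G z.
  by rewrite /G /W mul1r opprB addrA.
have chi2 e := is_derive_sub (is_derive_scale de (is_derive2_bpsi al 32^-1 c q e y0))
  (is_derive2_hlog e y0).
have cmp e : de * (psi y * (al ^+ 2 * bphi1 32^-1 c q e y ^+ 2 -
     al * bphi2 32^-1 c q e y)) -
    (edot e e / edot y y - 2 * edot y e ^+ 2 / edot y y ^+ 2) <= hess V y e.
  have [||||_] := @second_order_compare R m 1 V (fun z => de * psi z - hlog z)
    (fun z => de * bpsi1 al 32^-1 c q e z - edot z e / edot z z) y e _ _ _ _ (chi2 e).
  - exact: dV.
  - exact: ddV.
  - by apply: filterS (near_annulus ya y1) => z /annulus_gt0 z0; exact: chi1.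
  - by apply: filterS (near_annulus ya y1) => z /ymin; rewrite !Gchi.
  by rewrite mul1r subr_ge0.
have := le_trans (le_ellop y (leq_trans _ m3) cmp) (Lneg Ky).
rewrite ellop_sub ellop_bpsi // ellop_hlog // subr0 -/psi => /(_ isT).
apply/negP; rewrite -ltNge mulr_gt0 // mulr_gt0 //.
apply: lt_le_trans (mulr_gt0 al0 pos) _; rewrite le_eqVlt; apply/orP; left.
by apply/eqP; move: (edot y y) (edot y q) (rinv y) (m%:R : R) (al) => *; field.
Qed.

(** If W exceeds its minimum W(p) at q0, subtracting a small barrier centred near q0 traps a global
    minimum of the difference in a cap where W > W(p) + d0. Since the barrier term is at most d0
    there and positive at [p], the value at [p] is still lower. *)
Lemma strong_min : exists C : R, forall y, annulus y -> V y + hlog y = C.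
Proof.
have absurd_levels (wp wy A B d : R) :
    wy - A <= wp - B -> A <= d -> 0 < B -> wp + d < wy -> False by lra.
have m0 : (0 < m)%N by apply: leq_trans m3.
have m3' : 3 <= m%:R :> R by rewrite ler_nat.
have cW : {within annulus, continuous W}.
  by apply: continuous_in_subspaceT => y; rewrite inE; exact: cont_W.
have [p Kp pmin] := EVT_min_rV (annulus_nonempty m0) annulus_compact cW.
rewrite inE in Kp.
have {}pmin z : annulus z -> W p <= W z by move=> Kz; apply: pmin; rewrite inE.
exists (W p) => q0 Kq0; apply/eqP; rewrite -/(W q0) eq_le pmin // andbT leNgt.
apply/negP => Wq.
pose d0 := (W q0 - W p) / 2.
have d00 : 0 < d0 by rewrite divr_gt0 // subr_gt0.
have Wd : W p + d0 < W q0 by rewrite /d0; lra.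
have /nbhs_ballP[rr /= rr0 hrr] : \forall z \near q0, W p + d0 < W z.
  by apply: (cvgr_gt _ (cont_W Kq0)).
(* In the cap, squared distance to q0 is below 2 eta from the radii (eta for the cap, eta for the
   shift from |q0|^2 to [c]) plus 2 eta from the angle, so 4 eta <= rr^2 keeps the cap in the
   ball. *)
pose eta := Num.min 1 (rr ^+ 2 / 4).
have rr2 : 0 < rr ^+ 2 / 4 by rewrite divr_gt0 // exprn_gt0.
have eta0 : 0 < eta by rewrite lt_min ltr01.
have eta1 : eta <= 1 by rewrite ge_min lexx.
have etar : 4 * eta <= rr ^+ 2.
  have : eta <= rr ^+ 2 / 4 by rewrite ge_min lexx orbT.
  by lra.
have q00 := annulus_gt0 Kq0.
have /andP[q0a q01] := Kq0.
pose q := rinv q0 *: q0.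
have q1 : edot q q = 1.
  by rewrite edotZl edotZr mulrA -expr2 rinv_sqr // mulVf // gt_eqF.
(* The point q0 may lie on the boundary. Moving |q0|^2 towards the middle by a fraction [eta] gives
   [c] strictly between the squared radii, which the barrier needs for its radial signs on the two
   spheres. *)
pose c := edot q0 q0 + eta * ((a ^+ 2 + 1) / 2 - edot q0 q0).
have ca : a ^+ 2 < c.
  have : eta * (edot q0 q0 - a ^+ 2) <= 1 * (edot q0 q0 - a ^+ 2).
    by rewrite ler_wpM2r // subr_ge0.
  have : 0 < eta * (1 - a ^+ 2) by rewrite mulr_gt0 // subr_gt0.
  by rewrite /c; lra.
have c1 : c < 1.
  have : eta * (1 - edot q0 q0) <= 1 * (1 - edot q0 q0).
    by rewrite ler_wpM2r // subr_ge0.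
  have : 0 < eta * (1 - a ^+ 2) by rewrite mulr_gt0 // subr_gt0.
  by rewrite /c; lra.
have cq : `|c - edot q0 q0| <= eta.
  rewrite /c addrC addKr normrM gtr0_norm // ger_pMr // ler_norml.
  by have := a20; have := a21; lra.
pose al := 128 * (m%:R - 1) / ((a ^+ 2) ^+ 2 * eta ^+ 2).
have al0 : 0 < al.
  by rewrite divr_gt0 // ?mulr_gt0 // ?exprn_gt0 //; lra.
(* Since [bphi] is at least -1, the barrier is at most exp al, and this coefficient makes its
   contribution at most d0. *)
have de0 : 0 < d0 * expR (- al) by rewrite mulr_gt0 // expR_gt0.
have [y [Ky Nc xe ymin]] := barrier_min_in_cap q1 ca c1 eta0 eta1 de0.
have y0 := annulus_gt0 Ky.
have x1 : edot y q * rinv y <= 1.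
  have : (edot y q * rinv y) ^+ 2 <= 1.
    rewrite exprMn rinv_sqr // ler_pdivrMr // mul1r.
    by have := edot_Cauchy_Schwarz q y0; rewrite q1 mulr1.
  by move: (_ * rinv y) => x h; nra.
have xE : edot y q * rinv y = edot y q0 * (rinv y * rinv q0).
  by rewrite /q edotZr; ring.
have Wy : W p + d0 < W y.
  apply: hrr; rewrite -ball_normE /ball_ /= distrC; apply: edot_lt_norm => //.
  have h1 : 0 < edot y y <= 1 by rewrite y0; case/andP: Ky.
  have h2 : 0 < edot q0 q0 <= 1 by rewrite q00.
  have := dist_polar h1 h2; rewrite -xE => /(_ x1) h3.
  have := ler_distD c (edot y y) (edot q0 q0).
  by lra.
have psi_le : bpsi al 32^-1 c q y <= expR al.
  rewrite ler_expR /bphi.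
  have : 0 <= rquad 32^-1 c y.
    by rewrite /rquad mulr_ge0 // ?invr_ge0 // -expr2 sqr_ge0.
  move=> h; have : al * (1 + (rquad 32^-1 c y - edot y q * rinv y)) >= 0.
    by apply: mulr_ge0; [exact: ltW | lra].
  by lra.
have psiy : d0 * expR (- al) * bpsi al 32^-1 c q y <= d0.
  rewrite -mulrA ger_pMr // expRN mulrC ler_pdivrMr ?expR_gt0 //.
  by rewrite mul1r.
have psip : 0 < d0 * expR (- al) * bpsi al 32^-1 c q p.
  by rewrite mulr_gt0 // expR_gt0.
exact: absurd_levels (ymin p Kp) psiy psip Wy.
Qed.

End StrongMin.
End Annulus.

(** * The stereographic picture of the boundary value problem *)

Lemma cos_tan_half (R : realType) (t : R) : 0 < cos (t / 2) ->
  cos t = (1 - tan (t / 2) ^+ 2) / (1 + tan (t / 2) ^+ 2).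
Proof.
move=> c0; have cn0 : cos (t / 2) != 0 by rewrite gt_eqF.
rewrite {1}(_ : t = (t / 2) *+ 2); last by rewrite -mulr_natr divfK.
rewrite cos_mulr2n; have := cos2_tan2 cn0.
have s0 : 1 + tan (t / 2) ^+ 2 != 0 by rewrite gt_eqF // ltr_wpDr // sqr_ge0.
move=> E; have -> : cos (t / 2) ^+ 2 = (1 + tan (t / 2) ^+ 2)^-1.
  by rewrite -E invrK.
by rewrite -mulr_natr; field.
Qed.

Lemma sin_tan_half (R : realType) (t : R) : 0 < cos (t / 2) ->
  sin t = 2 * tan (t / 2) / (1 + tan (t / 2) ^+ 2).
Proof.
move=> c0; have cn0 : cos (t / 2) != 0 by rewrite gt_eqF.
rewrite {1}(_ : t = (t / 2) *+ 2); last by rewrite -mulr_natr divfK.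
rewrite sin_mulr2n -(cos2_tan2 cn0) /tan -mulr_natr.
by field.
Qed.

Section Stereo.
Variables (R : realType) (m : nat).
Implicit Types (y z : 'rV[R]_m) (x w : 'rV[R]_m.+1) (rho : 'rV[R]_m.+1 -> R).

Lemma edot_split x w : edot x w = x 0 ord_max * w 0 ord_max +
  \sum_(j < m) x 0 (lift ord_max j) * w 0 (lift ord_max j).
Proof. by rewrite /edot (bigD1_ord ord_max). Qed.

Lemma edot_npole x : edot x npole = x 0 ord_max.
Proof. exact: edot_evec. Qed.

Lemma onSphere_stereo y : onSphere (stereo y).
Proof.
have s0 : 1 + edot y y != 0 by rewrite gt_eqF // onePedot_gt0.
rewrite /onSphere edot_split stereo_max.
under eq_bigr => j _ do rewrite stereo_lift.
rewrite (eq_bigr (fun j => (4 / (1 + edot y y) ^+ 2) * (y 0 j * y 0 j))).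
  by rewrite -mulr_sumr -/(edot y y); field.
by move=> j _; field.
Qed.

Lemma sphere_coord x : onSphere x -> -1 <= x 0 ord_max <= 1.
Proof.
rewrite /onSphere edot_split => x1.
rewrite -ler_norml -(@expr_le1 _ 2) // real_normK ?num_real // -x1 expr2 lerDl.
by apply: sumr_ge0 => j _; rewrite -expr2 sqr_ge0.
Qed.

Lemma stereo_onto x : onSphere x -> -1 < x 0 ord_max ->
  exists2 y, stereo y = x &
    edot y y = (1 - x 0 ord_max) / (1 + x 0 ord_max).
Proof.
rewrite /onSphere edot_split => x1 xm.
have s0 : 1 + x 0 ord_max != 0 by rewrite gt_eqF //; lra.
pose y : 'rV[R]_m := \row_j (x 0 (lift ord_max j) / (1 + x 0 ord_max)).
have yE : edot y y = (1 - x 0 ord_max) / (1 + x 0 ord_max).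
  rewrite /edot (eq_bigr (fun j => (1 + x 0 ord_max) ^- 2 *
    (x 0 (lift ord_max j) * x 0 (lift ord_max j)))); last first.
    by move=> j _; rewrite !mxE; field.
  rewrite -mulr_sumr; move: x1; set S := \sum_(j < m) _ => x1.
  have -> : S = (1 - x 0 ord_max) * (1 + x 0 ord_max) by lra.
  by field.
have s2 : 1 + edot y y != 0 by rewrite gt_eqF // onePedot_gt0.
exists y => //; apply/rowP => i; case: (unliftP ord_max i) => [j ->|->].
  rewrite stereo_lift yE mxE; field; rewrite s0 /=.
  by rewrite (_ : _ + _ + _ = 2) ?pnatr_eq0 //; ring.
rewrite stereo_max yE; field; rewrite s0 /=.
by rewrite (_ : _ + _ + _ = 2) ?pnatr_eq0 //; ring.
Qed.

Section Radius.
Variable r : R.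
Hypothesis hr : 0 < r < pi / 2.
Let a := tan (r / 2).

Let cos0 : 0 < cos (r / 2).
Proof. by apply: cos_gt0_pihalf; case/andP: hr => *; apply/andP; split; lra. Qed.

Lemma tan_half_bounds : 0 < a < 1.
Proof.
case/andP: hr => r0 r1; have p0 := pi_gt0 R; apply/andP; split.
  by rewrite divr_gt0 // sin_gt0_pihalf //; apply/andP; split; lra.
rewrite -(tan_piquarter R) ltr_tan ?in_itv /=; first by lra.
  by apply/andP; split; lra.
by apply/andP; split; lra.
Qed.

Lemma closedAnnulusP x : closedAnnulus r x <->
  onSphere x /\ 0 <= x 0 ord_max <= cos r.
Proof.
have p0 := pi_gt0 R; have /andP[r0 r1] := hr.
split=> [[xS]|[xS h]].
  rewrite /sdist edot_npole => h; split=> //; have xI := sphere_coord xS.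
  have xi : x 0 ord_max \in `[-1, 1] by rewrite in_itv.
  have := acosK xi; have := acos_ge0 xI; have := acos_lepi xI.
  move: h; set t := acos _ => /andP[rt tp] t1 t0 <-.
  apply/andP; split.
    by apply: cos_ge0_pihalf; apply/andP; split; lra.
  rewrite leNgt; apply/negP; rewrite ltr_cos ?in_itv /=; first by lra.
    by apply/andP; split; lra.
  by apply/andP; split; lra.
split=> //; rewrite /sdist edot_npole; have xI := sphere_coord xS.
have xi : x 0 ord_max \in `[-1, 1] by rewrite in_itv.
have := acosK xi; have := acos_ge0 xI; have := acos_lepi xI.
set t := acos _ => t1 t0 E; rewrite -E in h; case/andP: h => h1 h2.
apply/andP; split; rewrite leNgt; apply/negP => tr.
  have : cos r < cos t; last by lra.
  rewrite ltr_cos ?in_itv //=; apply/andP; split; lra.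
have : cos t < cos (pi / 2); last by rewrite cos_pihalf; lra.
rewrite ltr_cos ?in_itv //=; apply/andP; split; lra.
Qed.

Lemma closedAnnulus_stereo y : closedAnnulus r (stereo y) <-> annulus a y.
Proof.
have s0 := onePedot_gt0 y; have a2 := sqr_ge0 a.
rewrite closedAnnulusP stereo_max cos_tan_half // -/a /annulus.
split.
- case=> _; rewrite ler_pdivlMr ?mul0r; last by [].
  rewrite ler_pdivrMr // mulrAC ler_pdivlMr; last by lra.
  by move=> /andP[h1 h2]; apply/andP; split; lra.
- move=> /andP[h1 h2]; split; first exact: onSphere_stereo.
  rewrite ler_pdivlMr ?mul0r; last by [].
  rewrite ler_pdivrMr // mulrAC ler_pdivlMr; last by lra.
  by apply/andP; split; lra.
Qed.

End Radius.

Definition equatorial y : 'rV[R]_m.+1 :=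
  \row_i (if unlift ord_max i is Some j then y 0 j else 0).

Lemma equatorial_lift y j : equatorial y 0 (lift ord_max j) = y 0 j.
Proof. by rewrite mxE liftK. Qed.

Lemma equatorial_max y : equatorial y 0 ord_max = 0.
Proof. by rewrite mxE unlift_none. Qed.

Lemma polar_stereo y t : edot y y = 1 -> 0 < cos (t / 2) ->
  polar t (equatorial y) = stereo (tan (t / 2) *: y).
Proof.
move=> y1 c0; have := sqr_ge0 (tan (t / 2)) => T0.
apply/rowP => i; rewrite mxE [X in X + _]mxE [X in _ + X]mxE.
have N : edot (tan (t / 2) *: y) (tan (t / 2) *: y) = tan (t / 2) ^+ 2.
  by rewrite edotZl edotZr y1 mulr1 expr2.
rewrite [X in _ * X + _]mxE eqxx /=.
case: (unliftP ord_max i) => [j ->|->].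
  rewrite equatorial_lift stereo_lift N mxE sin_tan_half //.
  rewrite eq_sym (negbTE (neq_lift _ _)) mulr0 add0r.
  by field; rewrite gt_eqF //; lra.
by rewrite eqxx equatorial_max stereo_max N cos_tan_half // mulr1 mulr0 addr0.
Qed.

(** Along a meridian |y| = tan (t / 2) has speed (1 + |y|^2) / 2; dividing by |y| expresses this
    velocity as a multiple of the radial field y. *)
Lemma radial_derive_polar rho y (t0 s0 : R) : 0 < t0 -> t0 <= pi / 2 ->
  s0 = tan (t0 / 2) -> edot y y = s0 ^+ 2 -> 0 < s0 ->
  differentiable (rho \o @stereo R m) y ->
  derive1 (fun t : R => rho (polar t (equatorial (s0^-1 *: y)))) t0 =
  (1 + s0 ^+ 2) / (2 * s0) * 'D_y (rho \o @stereo R m) y.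
Proof.
move=> t00 t01 s0E yN s00 du; have p0 := pi_gt0 R.
have c0 : 0 < cos (t0 / 2) by apply: cos_gt0_pihalf; apply/andP; split; lra.
have y1 : edot (s0^-1 *: y) (s0^-1 *: y) = 1.
  by rewrite edotZl edotZr yN; field; rewrite gt_eqF.
rewrite derive1E.
have half : is_derive t0 (1 : R) (fun t : R => t / 2) 2^-1.
  rewrite (_ : (fun t : R => t / 2) = fun t => 2^-1 * t); last first.
    by apply/funext => t; rewrite mulrC.
  by apply: (is_derive_eq (is_derive_scale 2^-1 (is_derive_id t0 (1 : R)))); rewrite mulr1.
have dtan : is_derive t0 (1 : R) (fun t : R => s0^-1 * tan (t / 2) - 1)
    (s0^-1 * ((cos (t0 / 2)) ^- 2 * 2^-1)).
  rewrite (_ : (fun t : R => _) = fun t => -1 + s0^-1 * tan (t / 2)); last first.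
    by apply/funext => t; rewrite addrC.
  apply: is_derive_addl; apply: is_derive_scale.
  apply: (@is_derive1_comp R (@tan R) (fun t => t / 2)) => //.
  by apply: is_derive_tan; rewrite gt_eqF.
have du0 : is_derive (s0^-1 * tan (t0 / 2) - 1) (1 : R)
    (fun s : R => (rho \o @stereo R m) (y + s *: y)) ('D_y (rho \o @stereo R m) y).
  rewrite -s0E mulVf ?gt_eqF // subrr; apply: is_derive_line.
  by rewrite scale0r addr0; apply/derivableP/diff_derivable.
have [_ dE] := @is_derive1_comp R _ _ t0 _ _ du0 dtan.
rewrite (near_eq_derive (g := (fun s : R => (rho \o @stereo R m) (y + s *: y)) \o
   (fun t : R => s0^-1 * tan (t / 2) - 1))).
  rewrite dE cos2_tan2 ?gt_eqF // -s0E; field; by rewrite gt_eqF.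
have cc : {for t0, continuous (fun t : R => cos (t / 2))}.
  apply: (@continuous_comp _ _ _ (fun t : R => t / 2) (@cos R)); last exact: continuous_cos.
  by apply: continuousM; [exact: cvg_id | exact: cst_continuous].
have nc : \forall t \near t0, 0 < cos (t / 2) by apply: (cvgr_gt _ cc).
apply: filterS nc => t ct /=; rewrite polar_stereo //; congr (rho (stereo _)).
by rewrite scalerBl scale1r scalerA addrC subrK mulrC.
Qed.

End Stereo.

(** * Solutions are constant in cylindrical coordinates *)

Section Regularity.
Variables (R : realType) (m : nat) (rho : 'rV[R]_m.+1 -> R) (U : set 'rV[R]_m).
Let u := rho \o @stereo R m.
Hypothesis Uopen : open U.
Hypothesis du : forall y, U y ->
  differentiable u y /\ forall j, differentiable (pd j u) y.

Lemma differentiable_ln_onePedot (y : 'rV[R]_m) :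
  differentiable (fun z : 'rV[R]_m => ln (1 + edot z z)) y.
Proof.
apply: (@differentiable_comp R _ _ _ (fun z : 'rV[R]_m => 1 + edot z z) (@ln R)).
  by apply: differentiableD => //; exact: differentiable_edot2.
by apply/derivable1_diffP; have [] := is_derive1_ln (onePedot_gt0 y).
Qed.

Lemma differentiable_confexp y : U y -> differentiable (confexp rho) y.
Proof.
move=> Uy; apply: differentiableB; last exact: differentiable_ln_onePedot.
by apply: differentiableD => //; exact: (du Uy).1.
Qed.

Lemma is_derive_confexp y v : U y -> is_derive y v (confexp rho)
  ('D_v u y - 2 * edot y v / (1 + edot y y)).
Proof.
move=> Uy; apply: is_derive_sub.
  rewrite (_ : (fun z => _) = fun z => ln 2 + u z); last first.
    by apply/funext => z; rewrite addrC.
  by apply: is_derive_addl; apply/derivableP/diff_derivable; exact: (du Uy).1.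
have h := @is_derive_comp_real R _ (fun z : 'rV[R]_m => 1 + edot z z) (@ln R) y v
  _ _ (is_derive1_ln (onePedot_gt0 y)) (is_derive_onePedot y v).
by apply: (is_derive_eq h); rewrite mulrC.
Qed.

Lemma near_differentiable_confexp y : U y ->
  \forall z \near y, differentiable (confexp rho) z.
Proof.
move=> Uy; have := open_nbhs_nbhs (conj Uopen Uy).
by apply: filterS => z; exact: differentiable_confexp.
Qed.

Lemma differentiable_pd_confexp y j : U y ->
  differentiable (pd j (confexp rho)) y.
Proof.
move=> Uy.
apply: (@differentiable_near_eq R _ _
  (fun z => pd j u z - 2 * z 0 j * (1 + edot z z)^-1)).
  have := open_nbhs_nbhs (conj Uopen Uy); apply: filterS => z Uz.
  have [_ E] := is_derive_confexp (evec j) Uz.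
  by rewrite -[RHS]/('D_(evec j) (confexp rho) z) E edot_evec.
apply: differentiableB; first exact: (du Uy).2.
apply: differentiableM.
  by apply: differentiableM => //; exact: differentiable_coord.
apply: differentiableV; last by rewrite gt_eqF // onePedot_gt0.
by apply: differentiableD => //; exact: differentiable_edot2.
Qed.

End Regularity.

Section SchoutenForm.
Variables (R : realType) (m : nat) (rho : 'rV[R]_m.+1 -> R) (y : 'rV[R]_m).
Let V := confexp rho.
Hypothesis dV : \forall z \near y, differentiable V z.
Hypothesis ddV : forall b, differentiable (pd b V) y.

Definition grad : 'rV[R]_m := \row_i pd i V y.

Lemma edot_grad : edot grad grad = \sum_k pd k V y ^+ 2.
Proof. by apply: eq_bigr => i _; rewrite !mxE expr2. Qed.

Lemma tr_schoutenV : (schoutenV rho y)^T = schoutenV rho y.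
Proof.
apply/matrixP => i j; rewrite !mxE (hess_sym dV ddV j i) (eq_sym j i).
move: (pd i (confexp rho) y) (pd j (confexp rho) y) => p q.
by rewrite (mulrC q p).
Qed.

Lemma qform_schoutenV x : qform (schoutenV rho y) x =
  edot x grad ^+ 2 - hess V y x - edot grad grad / 2 * edot x x.
Proof.
rewrite /qform (eq_bigr (fun i => \sum_j (x 0 i * pd i V y) * (x 0 j * pd j V y) -
  \sum_j x 0 i * pd i (pd j V) y * x 0 j - edot grad grad / 2 * (x 0 i * x 0 i))).
  rewrite !sumrB -mulr_sumr -/(edot x x); congr (_ - _ - _).
  rewrite expr2 /edot big_distrlr /=; apply: eq_bigr => i _.
  by apply: eq_bigr => j _; rewrite !mxE.
move=> i _; rewrite -(sum_delta i (fun j => edot grad grad / 2 * (x 0 i * x 0 j))).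
rewrite -!sumrB; apply: eq_bigr => j _; rewrite !mxE edot_grad (eq_sym i j).
by move: (pd i V y) (pd j V y) (pd i _ y) (\sum_k _) => p q h S; ring.
Qed.

Lemma hess_evec i : hess V y (evec i) = pd i (pd i V) y.
Proof.
rewrite /hess (eq_bigr (fun k => (k == i)%:R *
  \sum_j (j == i)%:R * pd k (pd j V) y)); first by rewrite !sum_delta.
move=> k _; rewrite mulr_sumr; apply: eq_bigr => j _; rewrite !evecE.
by move: (pd k _ y) => h; ring.
Qed.

Lemma mxtrace_schoutenV : \tr (schoutenV rho y) =
  (1 - m%:R / 2) * edot grad grad - \sum_i hess V y (evec i).
Proof.
rewrite /mxtrace (eq_bigr (fun i => (pd i V y ^+ 2 - edot grad grad / 2) -
   hess V y (evec i))); last first.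
  move=> i _; rewrite mxE hess_evec eqxx edot_grad mul1r.
  by move: (pd i V y) (pd i _ y) (\sum_k _) => p h S; ring.
rewrite !sumrB -edot_grad sumr_const card_ord -mulr_natr; ring.
Qed.

Hypothesis m3 : (3 <= m)%N.

Lemma tr_schEnd : (schEnd rho y)^T = schEnd rho y.
Proof. by rewrite schEndE // linearZ /= tr_schoutenV. Qed.

Lemma qform_schEnd x : qform (schEnd rho y) x =
  expR (- (2 * V y)) * qform (schoutenV rho y) x.
Proof.
rewrite schEndE // /qform mulr_sumr; apply: eq_bigr => i _.
by rewrite mulr_sumr; apply: eq_bigr => j _; rewrite mxE; ring.
Qed.

Lemma mxtrace_schEnd : \tr (schEnd rho y) =
  expR (- (2 * V y)) * \tr (schoutenV rho y).
Proof. by rewrite schEndE // mxtraceZ. Qed.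

End SchoutenForm.

(** * From the boundary value problem to the explicit solution *)

Section Solution.
Variables (R : realType) (m : nat) (r : R).
Hypothesis m3 : (3 <= m)%N.
Hypothesis hr : 0 < r < pi / 2.
Variables (f : 'rV[R]_m -> R) (Gam : set 'rV[R]_m).
Hypothesis hfG : elliptic_data f Gam.
Variable rho : 'rV[R]_m.+1 -> R.
Hypothesis hrho : solves_problem f Gam r rho.
Let a := tan (r / 2).
Let V := confexp rho.

Lemma solution_differentiable y : annulus a y ->
  [/\ differentiable (rho \o @stereo R m) y,
      \forall z \near y, differentiable V z,
      forall j, differentiable (pd j V) y &
      forall v, 'D_v V y =
        'D_v (rho \o @stereo R m) y - 2 * edot y v / (1 + edot y y)].
Proof.
move=> /closedAnnulus_stereo Ky.
have [[U [Uo KU du _ _]] _] := hrho.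
have Uy : U y by apply: KU; exact: Ky.
split.
- exact: (du y Uy).1.
- exact: (near_differentiable_confexp Uo du Uy).
- by move=> j; exact: (differentiable_pd_confexp Uo du j Uy).
- by move=> v; have [_ ->] := is_derive_confexp du v Uy.
Qed.

Lemma solution_neumann y : edot y y = 1 \/ edot y y = a ^+ 2 -> 'D_y V y = -1.
Proof.
have p0 := pi_gt0 R; have /andP[r0 r1] := hr.
have /andP[a0 a1] := tan_half_bounds hr; rewrite -/a in a0 a1.
have a2 : a ^+ 2 <= 1 by rewrite expr_le1 // ltW.
have [_ [_ hb]] := hrho.
(* Both boundary conditions say that the radial derivative of [rho] is - cot t0, as cot (pi / 2) =
   0, and cot t0 = (1 - s0^2) / (2 s0) for s0 = tan (t0 / 2). One computation therefore serves both
   spheres. *)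
suff key t0 s0 : 0 < t0 -> t0 <= pi / 2 -> s0 = tan (t0 / 2) -> 0 < s0 ->
    edot y y = s0 ^+ 2 -> annulus a y ->
    derive1 (fun t : R => rho (polar t (equatorial (s0^-1 *: y)))) t0 =
      - ((1 - s0 ^+ 2) / (2 * s0)) -> 'D_y V y = -1.
  have eqS s0 : 0 < s0 -> edot y y = s0 ^+ 2 ->
      onSphere (equatorial (s0^-1 *: y)).
    move=> s00 yN; rewrite /onSphere edot_split equatorial_max mul0r add0r.
    under eq_bigr do rewrite !equatorial_lift.
    by rewrite -/(edot _ _) edotZl edotZr yN; field; rewrite gt_eqF.
  case=> yN.
    have yN1 : edot y y = 1 ^+ 2 by rewrite yN expr1n.
    have [_ h] := hb _ (eqS 1 ltr01 yN1) (equatorial_max _).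
    apply: (key (pi / 2) 1) => //; first by lra.
      by rewrite -mulrA -invfM -natrM tan_piquarter.
      by rewrite /annulus yN lexx andbT.
    by rewrite h expr1n subrr mul0r oppr0.
  have [h _] := hb _ (eqS a a0 yN) (equatorial_max _).
  apply: (key r a) => //; first by lra.
    by rewrite /annulus yN lexx.
  have c0 : 0 < cos (r / 2) by apply: cos_gt0_pihalf; apply/andP; split; lra.
  rewrite h cos_tan_half // sin_tan_half // -/a; congr (- _).
  by field; rewrite !gt_eqF // ltr_wpDr // sqr_ge0.
move=> t00 t01 s0E s00 yN Ky.
have [du _ _ ->] := solution_differentiable Ky.
rewrite (radial_derive_polar t00 t01 s0E yN s00 du) yN.
move: ('D_y _ y) => D h.
have s1 : 0 < 1 + s0 ^+ 2 by rewrite ltr_wpDr // sqr_ge0.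
have -> : D = - ((1 - s0 ^+ 2) / (1 + s0 ^+ 2)).
  have -> : D = (2 * s0) / (1 + s0 ^+ 2) * ((1 + s0 ^+ 2) / (2 * s0) * D).
    by field; rewrite !gt_eqF.
  by rewrite h; field; rewrite !gt_eqF.
by field; rewrite gt_eqF.
Qed.

(** In the radial direction the gradient terms of the Schouten tensor combine to (m - 2) (<y, dV>^2
    - |y|^2 |dV|^2), which is nonpositive by Cauchy-Schwarz, so the quadratic inequality leaves a
    linear one. *)
Lemma solution_supersolution (j0 : 'I_m) y : ~ Gam (spike 2 j0) -> annulus a y ->
  ellop (hess V y) y <= 0.
Proof.
move=> nG Ky; have [_ dV ddV _] := solution_differentiable Ky.
have [[Go Gc Gk Gs [Gp Gsum]] _] := hfG.
have [_ [hl _]] := hrho.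
have [lam [Alam [clam _]]] := hl y ((closedAnnulus_stereo hr y).2 Ky).
have := qform_ge_of_closure Go Gc Gk Gs Gp Gsum (tr_schEnd dV ddV m3) Alam y m3 nG clam.
rewrite (qform_schEnd dV ddV m3) (mxtrace_schEnd dV ddV m3).
have /andP[a0 a1] := tan_half_bounds hr.
have y0 : 0 < edot y y by apply: (annulus_gt0 (a := a)) => //; apply/andP.
rewrite (mulrCA (m%:R - 2)) (mulrCA (edot y y)) -mulrDr.
rewrite pmulr_rge0 ?expR_gt0 // qform_schoutenV mxtrace_schoutenV.
have := edot_Cauchy_Schwarz (grad rho y) y0; rewrite /ellop -/V.
have m3' : 3 <= m%:R :> R by rewrite ler_nat.
move: (edot (grad _ _) (grad _ _)) (edot y (grad _ _)) (edot y y) => S b N.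
move: (hess V y y) (\sum_i _) (m%:R : R) m3' => h T M M3 cs hq.
have : (M - 2) * b ^+ 2 <= (M - 2) * (N * S) by rewrite ler_wpM2l //; lra.
by move: (b ^+ 2) cs hq => B cs hq ?; lra.
Qed.

(* If (-1, 1, ..., 1) lies in the open cone, then at an interior maximum of the
   cylindrical conformal factor, slightly tilted to keep it off the boundary,
   the eigenvalues are in the open cone as well, where [f] is positive. *)
Lemma spike_notin_cone (j0 : 'I_m) : ~ Gam (spike 2 j0).
Proof.
move=> Gj; have /andP[a0 a1] := tan_half_bounds hr; rewrite -/a in a0 a1.
have a01 : 0 < a < 1 by apply/andP.
have a2 : a ^+ 2 < 1 by rewrite expr_lt1 // ltW.
have a20 : 0 < a ^+ 2 by rewrite exprn_gt0.
have [[Go Gc Gk Gs [Gp Gsum]] [[_ _ _ _ [_ fpos]] _]] := hfG.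
have [eta eta0 Geta] := cone_spike_open Go Gc Gk Gp Gj.
(* The bound 1/8 ensures sig >= 3/8 below. The tilt raises tau |y|^2 - 2 sig by at most 16 ep, and
   16 * 3 eta / 128 = 3 eta / 8 is within eta sig. *)
pose ep := Num.min 8^-1 (3 * eta / 128).
have ep0 : 0 < ep by rewrite lt_min invr_gt0 ltr0n divr_gt0 // mulr_gt0.
have ep1 : ep <= 8^-1 by rewrite ge_min lexx.
have ep2 : ep <= 3 * eta / 128 by rewrite ge_min lexx orbT.
(* Centred between the squared radii, the tilt has positive outward derivative on the outer sphere
   and negative on the inner one, where that of w vanishes; the minimum of [G], that is of the tilt
   minus w, is then interior. *)
pose c := (a ^+ 2 + 1) / 2.
pose G : 'rV[R]_m -> R := fun z => -1 * (V z - (rquad ep c z - hlog z)).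
have dG y : annulus a y -> edot y y = 1 \/ edot y y = a ^+ 2 ->
    is_derive y y G (4 * ep * ((edot y y - c) * edot y y)).
  move=> Ky yb; have [_ dV _ _] := solution_differentiable Ky.
  have y0 := annulus_gt0 a01 Ky.
  have dVy : is_derive y y V (-1).
    rewrite -(solution_neumann yb); apply/derivableP/diff_derivable.
    exact: nbhs_singleton dV.
  have h := is_derive_scale (-1) (is_derive_sub dVy
    (is_derive_sub (is_derive_rquad ep c y y) (is_derive_hlog y y0))).
  by apply: (is_derive_eq h); rewrite divff ?gt_eqF //; ring.
have [||y yN|y yN|y [ya y1 ymin]] := @annulus_interior_min R m a a01 G.
- by apply: leq_trans m3.
- apply: continuous_in_subspaceT => y; rewrite inE => Ky.
  have [_ dV _ _] := solution_differentiable Ky.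
  have y0 := annulus_gt0 a01 Ky.
  have cN : {for y, continuous (fun z : 'rV[R]_m => edot z z)}.
    by apply: differentiable_continuous; exact: differentiable_edot2.
  apply: (@continuousM _ _ (fun=> -1) (fun z => V z - (rquad ep c z - hlog z))).
    exact: cst_continuous.
  apply: continuousB.
    by apply: differentiable_continuous; exact: nbhs_singleton dV.
  apply: continuousB; last exact: cont_hlog.
  apply: continuousM; first exact: cst_continuous.
  by apply: continuousM; apply: continuousB => //; exact: cst_continuous.
- exists (4 * ep * ((edot y y - c) * edot y y)); last first.
    by apply: dG; [rewrite /annulus yN lexx ltW | left].
  by rewrite yN mulr1 mulr_gt0 ?mulr_gt0 // /c; lra.
- exists (4 * ep * ((edot y y - c) * edot y y)); last first.
    by apply: dG; [rewrite /annulus yN lexx ltW | right].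
  rewrite yN pmulr_rlt0 ?mulr_gt0 // pmulr_llt0 // /c; lra.
have Ky : annulus a y by rewrite /annulus !ltW.
have y0 := annulus_gt0 a01 Ky.
have [_ dV ddV _] := solution_differentiable Ky.
have chi1 z e : 0 < edot z z -> is_derive z e (fun z => rquad ep c z - hlog z)
    (4 * ep * ((edot z z - c) * edot z e) - edot z e / edot z z).
  by move=> z0; apply: is_derive_sub; [exact: is_derive_rquad | exact: is_derive_hlog].
have nK := near_annulus ya y1.
have dchi e : \forall z \near y, is_derive z e (fun z => rquad ep c z - hlog z)
    (4 * ep * ((edot z z - c) * edot z e) - edot z e / edot z z).
  by apply: filterS nK => z /(annulus_gt0 a01) z0; exact: chi1.
have Gmin : \forall z \near y, -1 * (V y - (rquad ep c y - hlog y)) <=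
    -1 * (V z - (rquad ep c z - hlog z)).
  by apply: filterS nK => z /ymin.
have cmp e : 'D_e V y = (4 * ep * (edot y y - c) - (edot y y)^-1) * edot y e /\
    hess V y e <= 8 * ep * edot y e ^+ 2 + 4 * ep * (edot y y - c) * edot e e -
      (edot e e / edot y y - 2 * edot y e ^+ 2 / edot y y ^+ 2).
  have [h1 h2] := second_order_compare dV ddV (dchi e)
    (is_derive_sub (is_derive2_rquad ep c y e) (is_derive2_hlog e y0)) Gmin.
  split; last by lra.
  by move/eqP: h1; rewrite mulN1r oppr_eq0 subr_eq0 => /eqP ->; ring.
have [_ [hl _]] := hrho.
have [lam [Alam [clam f0]]] := hl y ((closedAnnulus_stereo hr y).2 Ky).
suff : Gam lam by move=> /fpos; rewrite f0 ltxx.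
pose E := expR (- (2 * V y)); have E0 : 0 < E by exact: expR_gt0.
pose be := 4 * ep * (edot y y - c) - (edot y y)^-1.
(* At the extremum dV equals be y, and the Hessian comparison gives A >= sig I - tau y y^T. For ep =
   0 these are sig = 1 / (2 |y|^2) and tau = 1 / |y|^4, so tau |y|^2 = 2 sig, the cylinder
   itself. *)
pose sig := (edot y y)^-1 - 4 * ep * (edot y y - c) - 2^-1 * (be ^+ 2 * edot y y).
pose tau := 8 * ep + 2 / edot y y ^+ 2 - be ^+ 2.
have gE : grad rho y = be *: y.
  apply/rowP => i; rewrite !mxE -[y 0 i]edot_evec.
  by have [h _] := cmp (evec i); exact: h.
have kap : (4 * ep * (edot y y - c)) ^+ 2 <= 4^-1.
  have h1 : `|4 * ep * (edot y y - c)| <= 2^-1.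
    rewrite normrM ger0_norm; last by lra.
    have : `|edot y y - c| <= 1 by rewrite ler_norml /c; apply/andP; split; lra.
    move=> h; have : 4 * ep * `|edot y y - c| <= 4 * ep * 1.
      by rewrite ler_wpM2l //; lra.
    by lra.
  rewrite -real_normK ?num_real // (_ : 4^-1 = 2^-1 ^+ 2 :> R); last by field.
  by rewrite !expr2 ler_pM.
have sigE : sig = (edot y y)^-1 / 2 - edot y y * (4 * ep * (edot y y - c)) ^+ 2 / 2.
  by rewrite /sig /be; field; rewrite gt_eqF.
have Ninv : 1 <= (edot y y)^-1 by rewrite invf_ge1 // ltW.
have sig38 : 3 / 8 <= sig.
  have : edot y y * (4 * ep * (edot y y - c)) ^+ 2 <= 1 * 4^-1.
    by apply: ler_pM; [exact: ltW | exact: sqr_ge0 | exact: ltW | exact: kap].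
  by rewrite sigE; lra.
have tauE : tau * edot y y = 2 * sig + 8 * ep * edot y y + 8 * ep * (edot y y - c).
  by rewrite /tau /sig /be; field; rewrite gt_eqF.
have taule : tau * edot y y <= (2 + eta) * sig.
  rewrite tauE.
  have : ep * edot y y <= ep * 1 by rewrite ler_wpM2l // ltW.
  have : ep * (edot y y - c) <= ep * 1 by apply: ler_wpM2l; [exact: ltW | rewrite /c; lra].
  have : eta * (3 / 8) <= eta * sig by rewrite ler_wpM2l // ltW.
  by lra.
apply: (eigenvalues_in_cone Go Gc Gk Gs Gp (tr_schEnd dV ddV m3) Alam Geta
  (z := y) (sig := E * sig) (tau := E * tau)) => //.
- by rewrite mulr_gt0 //; lra.
- by rewrite -mulrA [leRHS]mulrCA ler_pM2l.
- move=> x; rewrite (qform_schEnd dV ddV m3) -/V -/E -!mulrA -mulrBr ler_pM2l //.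
  rewrite qform_schoutenV gE !(edotZl, edotZr) (edotC x y) -/V.
  have [_] := cmp x; rewrite /sig /tau.
  move: (hess V y x) (edot y x) (edot x x) (be) => h P n b.
  have -> : n / edot y y = (edot y y)^-1 * n by rewrite mulrC.
  have -> : 2 * P ^+ 2 / edot y y ^+ 2 = (2 / edot y y ^+ 2) * P ^+ 2 by ring.
  move: (edot y y)^-1 (2 / edot y y ^+ 2) (edot y y) => Ni N2 N.
  by rewrite exprMn; lra.
Qed.

Lemma solution_constant : exists C : R, forall y, annulus a y -> V y + hlog y = C.
Proof.
have j0 : 'I_m by apply: (@Ordinal m 0); apply: leq_trans m3.
apply: (strong_min (tan_half_bounds hr) m3).
- by move=> y /solution_differentiable[].
- by move=> y /solution_differentiable[].
- by move=> y; apply: (solution_supersolution (@spike_notin_cone j0)).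
- exact: solution_neumann.
Qed.

(** Constancy of w written back on the sphere: [N] is |y|^2, a function of the height alone. A
    solution is thus determined up to the additive constant, which yields both the symmetry and the
    uniqueness. *)
Lemma solution_formula : exists C : R, forall x, closedAnnulus r x ->
  let N := (1 - x 0 ord_max) / (1 + x 0 ord_max) in
  rho x = C + ln (1 + N) - 2^-1 * ln N.
Proof.
have [C hC] := solution_constant; exists (C - ln 2) => x Kx N.
have [xS /andP[x0 _]] := (closedAnnulusP hr x).1 Kx.
have xm : -1 < x 0 ord_max by lra.
have [y yx yN] := stereo_onto xS xm.
have Ky : annulus a y by apply/(closedAnnulus_stereo hr); rewrite yx.
have := hC y Ky; rewrite /V /confexp /hlog yx yN -/N; lra.
Qed.

End Solution.

Theorem mainTheorem17 (R : realType) (m : nat) (hm : (3 <= m)%N)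
  (r : R) (hr : 0 < r < pi / 2)
  (f : 'rV[R]_m -> R) (Gam : set 'rV[R]_m) (hfG : elliptic_data f Gam)
  (rho : 'rV[R]_m.+1 -> R) (hrho : solves_problem f Gam r rho) :
  (* rotational invariance: rho depends only on d(x, n) *)
  (forall x y : 'rV[R]_m.+1, closedAnnulus r x -> closedAnnulus r y ->
     sdist x npole = sdist y npole -> rho x = rho y) /\
  (* uniqueness up to dilations *)
  (forall rho1 : 'rV[R]_m.+1 -> R, solves_problem f Gam r rho1 ->
     exists t : R, forall x, closedAnnulus r x -> rho1 x = rho x + t).
Proof.
have [C hC] := solution_formula hm hr hfG hrho; split=> [x y Kx Ky|rho1 hrho1].
  have xI := sphere_coord Kx.1; have yI := sphere_coord Ky.1.
  rewrite /sdist !edot_npole => /(congr1 cos).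
  rewrite !acosK ?in_itv // => xy.
  by rewrite (hC x Kx) (hC y Ky) xy.
have [C1 hC1] := solution_formula hm hr hfG hrho1.
exists (C1 - C) => x Kx; rewrite (hC x Kx) (hC1 x Kx); lra.
Qed.
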